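(* There exist a computable probability measure $\mu$ on $2^\omega$ and a sequence $X\in 2^\omega$ such that $X$ is not computably $\mu$-random, yet no total computable $\mu$-martingale succeeds on $X$.
   Context: For a probability measure $\mu$ on $2^\omega$ write $\mu(\sigma)=\mu([\sigma])$, where $[\sigma]$ is the set of sequences extending the string $\sigma$. $\mu$ is computable if $\sigma\mapsto\mu(\sigma)$ is a computable real uniformly in $\sigma$. A martingale with respect to $\mu$ (a $\mu$-martingale) is a partial function $M:2^{<\omega}\to[0,\infty)$ such that (i) $M(\sigma)$ is defined whenever $\mu(\sigma)>0$, and (ii) $M(\sigma 0)\mu(\sigma 0)+M(\sigma 1)\mu(\sigma 1)=M(\sigma)\mu(\sigma)$ for all $\sigma$ (terms with $\mu(\cdot)=0$ are treated as $0$). $M$ is computable if there is a partial computable procedure which, on each $\sigma$ in its domain, outputs a Cauchy name of the real $M(\sigma)$; it is total if it is defined on all of $2^{<\omega}$. $M$ succeeds on $X$ if $\limsup_n M(X\upharpoonright n)=\infty$. $X$ is computably $\mu$-random if no computable (possibly partial) $\mu$-martingale succeeds on $X$. *)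

(* Defs.v *)
From Stdlib Require Import Reals List Arith.
Import ListNotations.
Open Scope R_scope.

Inductive code : Type :=
| CZero
| CSucc
| CProj (i : nat)
| CComp (f : code) (gs : list code)
| CPrim (f g : code)
| CMu (f : code).

Fixpoint eval (k : nat) (c : code) (v : list nat) {struct k} : option nat :=
  match k with
  | O => None
  | S k' =>
    match c with
    | CZero => Some 0%nat
    | CSucc => Some (S (hd 0%nat v))
    | CProj i => Some (nth i v 0%nat)
    | CComp f gs =>
        match (fix evals (gs : list code) : option (list nat) :=
                 match gs with
                 | [] => Some []
                 | g :: gs' =>
                     match eval k' g v, evals gs' with
                     | Some a, Some w => Some (a :: w)
                     | _, _ => None
                     end
                 end) gs with
        | Some w => eval k' f w
        | None => None
        end
    | CPrim f g =>
        match hd 0%nat v with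
        | O => eval k' f (tl v)
        | S x => match eval k' (CPrim f g) (x :: tl v) with
                 | Some r => eval k' g (x :: r :: tl v)
                 | None => None
                 end
        end
    | CMu f =>
        (fix search (i fuel : nat) : option nat :=
           match fuel with
           | O => None
           | S fu => match eval k' f (i :: v) with
                     | Some O => Some i
                     | Some _ => search (S i) fu
                     | None => None
                     end
           end) 0%nat k'
    end
  end.

Definition halts_with (c : code) (v : list nat) (o : nat) : Prop :=
  exists k, eval k c v = Some o.

Definition diverges (c : code) (v : list nat) : Prop :=
  forall k, eval k c v = None.

(** Bijective coding of binary strings by naturals. *)
Fixpoint strcode (s : list bool) : nat :=
  match s with
  | [] => 0%nat
  | b :: s' => (2 * strcode s' + 1 + (if b then 1 else 0))%nat
  end.

(** Bijective enumeration nat -> nat * nat (Cantor-style unpairing). *)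
Fixpoint unpair (o : nat) : nat * nat :=
  match o with
  | O => (0%nat, 0%nat)
  | S o' => let (a, b) := unpair o' in
            match a with
            | O => (S b, 0%nat)
            | S a' => (a', S b)
            end
  end.

Definition int_of_code (a : nat) : R :=
  if Nat.even a then INR (a / 2) else - INR ((a + 1) / 2).

Definition rat_of_code (o : nat) : R :=
  let (a, b) := unpair o in int_of_code a / INR (S b).

Definition computes_Cauchy_name (c : code) (args : list nat) (x : R) : Prop :=
  forall n : nat, exists o, halts_with c (args ++ [n]) o /\
                  Rabs (rat_of_code o - x) <= (/ 2) ^ n.

Definition prefix (X : nat -> bool) (n : nat) : list bool := map X (seq 0 n).

(** A probability measure on 2^omega, given by its values mu(sigma) = mu([sigma])
    on basic cylinders (extending sigma by b is [sigma ++ [b]]). *)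
Definition prob_measure (mu : list bool -> R) : Prop :=
  mu [] = 1 /\
  (forall s, 0 <= mu s) /\
  (forall s, mu s = mu (s ++ [false]) + mu (s ++ [true])).

Definition computable_measure (mu : list bool -> R) : Prop :=
  exists c, forall s, computes_Cauchy_name c [strcode s] (mu s).

Definition mterm (mu : list bool -> R) (M : list bool -> option R) (s : list bool) : R :=
  match M s with Some x => x * mu s | None => 0 end.

Definition martingale (mu : list bool -> R) (M : list bool -> option R) : Prop :=
  (forall s, 0 < mu s -> M s <> None) /\
  (forall s x, M s = Some x -> 0 <= x) /\
  (forall s, mterm mu M (s ++ [false]) + mterm mu M (s ++ [true]) = mterm mu M s).

Definition computable_martingale (M : list bool -> option R) : Prop :=
  exists c, forall s,
    (forall x, M s = Some x -> computes_Cauchy_name c [strcode s] x) /\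
    (M s = None -> forall n, diverges c [strcode s; n]).

Definition total (M : list bool -> option R) : Prop := forall s, M s <> None.

Definition succeeds (M : list bool -> option R) (X : nat -> bool) : Prop :=
  (forall n, M (prefix X n) <> None) /\
  (forall B : R, exists n x, M (prefix X n) = Some x /\ B < x).

Definition computably_random (mu : list bool -> R) (X : nat -> bool) : Prop :=
  forall M, martingale mu M -> computable_martingale M -> ~ succeeds M X.

(* Main.v *)
Require Import Defs.
From Coquelicot Require Import Coquelicot.
From Stdlib Require Import Reals List Arith Lia Bool Lra ClassicalEpsilon.
Import ListNotations.
Local Open Scope nat_scope.

(** The sequence [X = 1 g_0 1 g_1 ...] guesses with its bit [g_e] whether the program number [e]
    computes a total martingale. The measure [mu] is a sum of atoms: a string [p] of length [2m]
    made of guesses receives the atom [p 0 0 0 ...], once for every stage by which all the programs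
    [e < m] that it guesses to be total have returned their values, up to [2^-m], on [p], [p1],
    [p10] and [p11] (and likewise for the shorter guesses that [p] extends). Whether [mu p > 0] is
    thus only known after these programs have committed themselves. If one of them has then
    announced a value at an extension [q] of [p] clearly larger than its value at [p], the whole
    mass of [p] is put on [q] instead, so that this program does not compute a [mu]-martingale.
    Hence, along the path of correct guesses, the value of a total martingale grows by at most
    [4 / 2^m] from the node of length [2m] to the next one, and stays bounded. The atom with index
    [j] has weight [3/4 * 4^-j] in [mu]; giving it weight [1/2 * 2^-j] instead yields a measure
    [nu], and the partial computable martingale [nu / mu] tends to infinity along [X], since only
    atoms of index at least [m] lie above the [m]-th node. *)

(** * The evaluator: monotonicity in the fuel, and halting rules for its constructors *)

(** [evals] and [search] name the anonymous fixpoints inside [eval], with the evaluator abstracted,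
    so that inductions on them can be stated; they agree with [eval] by conversion. *)
Definition evals (ev : code -> option nat) : list code -> option (list nat) :=
  fix evals (gs : list code) : option (list nat) :=
    match gs with
    | [] => Some []
    | g :: gs' =>
        match ev g, evals gs' with
        | Some a, Some w => Some (a :: w)
        | _, _ => None
        end
    end.

Definition search (ev : nat -> option nat) : nat -> nat -> option nat :=
  fix search (i fuel : nat) : option nat :=
    match fuel with
    | O => None
    | S fu => match ev i with
              | Some O => Some i
              | Some _ => search (S i) fu
              | None => None
              end
    end.

Lemma eval_CComp k f gs v :
  eval (S k) (CComp f gs) v =
  match evals (fun g => eval k g v) gs with Some w => eval k f w | None => None end.
Proof. reflexivity. Qed.

Lemma eval_CPrim k f g v :
  eval (S k) (CPrim f g) v =
  match hd 0 v with
  | O => eval k f (tl v)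
  | S x => match eval k (CPrim f g) (x :: tl v) with
           | Some r => eval k g (x :: r :: tl v)
           | None => None
           end
  end.
Proof. reflexivity. Qed.

Lemma eval_CMu k f v :
  eval (S k) (CMu f) v = search (fun i => eval k f (i :: v)) 0 k.
Proof. reflexivity. Qed.

Lemma evals_ext (ev ev' : code -> option nat) gs w :
  (forall g o, ev g = Some o -> ev' g = Some o) ->
  evals ev gs = Some w -> evals ev' gs = Some w.
Proof.
  intros H; revert w; induction gs as [|g gs IH]; simpl; intros w; auto.
  destruct (ev g) eqn:E; [|discriminate].
  destruct (evals ev gs) eqn:E2; [|discriminate].
  rewrite (H _ _ E), (IH _ eq_refl); auto.
Qed.

(** In [eval] the fuel bounds both the single evaluations and the length of the search, so both are
    allowed to grow at once. *)
Lemma search_ext (ev ev' : nat -> option nat) fuel fuel' i o :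
  (forall g o, ev g = Some o -> ev' g = Some o) -> fuel <= fuel' ->
  search ev i fuel = Some o -> search ev' i fuel' = Some o.
Proof.
  intros H; revert fuel' i; induction fuel as [|fu IH]; simpl; intros fuel' i L; [discriminate|].
  destruct fuel' as [|fu']; [lia|]; simpl.
  destruct (ev i) as [x|] eqn:E; [|discriminate].
  rewrite (H _ _ E); destruct x; auto; apply IH; lia.
Qed.

Lemma eval_S k c v o : eval k c v = Some o -> eval (S k) c v = Some o.
Proof.
  revert c v o; induction k as [|k IH]; intros c v o; [discriminate|].
  destruct c; auto.
  - rewrite !eval_CComp; destruct (evals _ gs) as [w|] eqn:E; [|discriminate].
    rewrite (evals_ext _ (fun g => eval (S k) g v) _ _ (fun g => IH g v) E); auto.
  - rewrite !eval_CPrim; destruct (hd 0 v) as [|x]; auto.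
    destruct (eval k (CPrim c1 c2) (x :: tl v)) as [r|] eqn:E; [|discriminate].
    rewrite (IH _ _ _ E); auto.
  - rewrite !eval_CMu; apply search_ext; auto.
Qed.

Lemma eval_le k k' c v o : k <= k' -> eval k c v = Some o -> eval k' c v = Some o.
Proof. induction 1; auto using eval_S. Qed.

Lemma halts_with_fun c v o o' : halts_with c v o -> halts_with c v o' -> o = o'.
Proof.
  intros [k H] [k' H'].
  apply (eval_le _ (k + k')) in H; [|lia]; apply (eval_le _ (k + k')) in H'; [|lia]; congruence.
Qed.

Lemma evals_halts v gs os :
  Forall2 (fun g o => halts_with g v o) gs os ->
  exists k, forall k', k <= k' -> evals (fun g => eval k' g v) gs = Some os.
Proof.
  induction 1 as [|g o gs os [k1 H1] _ [k2 H2]].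
  - exists 0; reflexivity.
  - exists (k1 + k2); intros k' L; simpl.
    rewrite (eval_le _ _ _ _ _ (Nat.le_trans _ _ _ (Nat.le_add_r k1 k2) L) H1), H2; auto; lia.
Qed.

Lemma halts_CComp f gs v os o :
  Forall2 (fun g o => halts_with g v o) gs os -> halts_with f os o ->
  halts_with (CComp f gs) v o.
Proof.
  intros [k H]%evals_halts [k' H'].
  exists (S (k + k')); rewrite eval_CComp, H by lia.
  apply (eval_le k'); auto; lia.
Qed.

Lemma halts_CPrim f g v (F : nat -> nat) :
  halts_with f v (F 0) -> (forall x, halts_with g (x :: F x :: v) (F (S x))) ->
  forall n, halts_with (CPrim f g) (n :: v) (F n).
Proof.
  intros [k H] Hg; induction n as [|n [k1 IH]].
  - exists (S k); rewrite eval_CPrim; auto.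
  - destruct (Hg n) as [k2 H2]; exists (S (k1 + k2)); rewrite eval_CPrim; simpl hd; cbv iota.
    simpl tl; rewrite (eval_le k1 _ _ _ (F n)); auto; try lia.
    apply (eval_le k2); auto; lia.
Qed.

Lemma halts_CMu f v (F : nat -> nat) n :
  (forall i, halts_with f (i :: v) (F i)) -> F n = 0 -> (forall i, i < n -> F i <> 0) ->
  halts_with (CMu f) v n.
Proof.
  intros H Hn Hl.
  (* One amount of fuel has to serve all the trials up to [n]. *)
  assert (Hk : exists k, forall i, i <= n -> eval k f (i :: v) = Some (F i)).
  { clear Hn Hl; induction n as [|n [k IH]].
    - destruct (H 0) as [k E]; exists k; intros i L; replace i with 0 by lia; auto.
    - destruct (H (S n)) as [k' E]; exists (k + k'); intros i L.
      destruct (Nat.eq_dec i (S n)) as [->|].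
      + apply (eval_le k'); auto; lia.
      + apply (eval_le k); [lia|]; apply IH; lia. }
  destruct Hk as [k Hk].
  (* The summand [S n] pays for the [n + 1] trials of the search. *)
  exists (S (k + S n)); rewrite eval_CMu.
  assert (G : forall d i fuel, n = i + d -> d < fuel ->
    search (fun i => eval (k + S n) f (i :: v)) i fuel = Some n).
  { induction d as [|d IH]; intros i [|fu] E L; try lia; simpl.
    - rewrite (eval_le k _ _ _ (F i)) by (lia || apply Hk; lia).
      replace i with n by lia; rewrite Hn; auto.
    - rewrite (eval_le k _ _ _ (F i)) by (lia || apply Hk; lia).
      destruct (F i) eqn:Ei; [exfalso; apply (Hl i); lia || auto|].
      apply IH; lia. }
  apply (G n); lia.
Qed.

Lemma CMu_diverges f v (F : nat -> nat) :
  (forall i, halts_with f (i :: v) (F i)) -> (forall i, F i <> 0) -> diverges (CMu f) v.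
Proof.
  intros H HF [|k]; auto; rewrite eval_CMu.
  assert (G : forall fuel i, search (fun i => eval k f (i :: v)) i fuel = None).
  { induction fuel as [|fu IH]; intros i; simpl; auto.
    destruct (eval k f (i :: v)) as [[|x]|] eqn:E; auto.
    exfalso; apply (HF i), (halts_with_fun f (i :: v)); auto; exists k; auto. }
  apply G.
Qed.

(** Composition is strict. The program for the martingale [ratio] has its unbounded search as first
    argument. *)
Lemma CComp_diverges f g gs v : diverges g v -> diverges (CComp f (g :: gs)) v.
Proof. intros H [|k]; auto; rewrite eval_CComp; simpl; rewrite (H k); auto. Qed.

(** * Total computable functions *)

Definition computable (k : nat) (f : list nat -> nat) : Prop :=
  exists c, forall v, length v = k -> halts_with c v (f v).

Definition decidable (k : nat) (p : list nat -> bool) : Prop :=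
  computable k (fun v => Nat.b2n (p v)).

Lemma computable_ext k f g :
  (forall v, length v = k -> f v = g v) -> computable k f -> computable k g.
Proof. intros E [c H]; exists c; intros v L; rewrite <- E; auto. Qed.

Lemma computable_proj k i : computable k (fun v => nth i v 0).
Proof. exists (CProj i); intros v _; exists 1; reflexivity. Qed.

Lemma computable_S k a : computable k a -> computable k (fun v => S (a v)).
Proof.
  intros [c H]; exists (CComp CSucc [c]); intros v L.
  apply (halts_CComp _ _ _ [a v]); [repeat constructor; auto|exists 1; reflexivity].
Qed.

Lemma computable_const k n : computable k (fun _ => n).
Proof.
  induction n as [|n IH].
  - exists CZero; intros v _; exists 1; reflexivity.
  - apply (computable_S _ _ IH).
Qed.

Lemma computable_comp k (gs : list (list nat -> nat)) f :
  computable (length gs) f -> Forall (computable k) gs ->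
  computable k (fun v => f (map (fun g => g v) gs)).
Proof.
  intros [c H] Hg.
  assert (exists cs, forall v, length v = k ->
    Forall2 (fun g o => halts_with g v o) cs (map (fun g => g v) gs)) as [cs Hcs].
  { clear H; induction Hg as [|g gs [c' Hc] _ [cs Hcs]].
    - exists []; constructor.
    - exists (c' :: cs); intros v L; constructor; auto. }
  exists (CComp c cs); intros v L.
  eapply halts_CComp; eauto.
  apply H; rewrite length_map; auto.
Qed.

Lemma computable_tl k a : computable k a -> computable (S k) (fun v => a (tl v)).
Proof.
  intros H.
  assert (E : forall v, length v = S k ->
    map (fun g : list nat -> nat => g v) (map (fun i v => nth i v 0) (seq 1 k)) = tl v).
  { intros [|x v] L; [discriminate|]; simpl in *; injection L as L.
    rewrite map_map; rewrite <- seq_shift, map_map; simpl; subst k.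
    clear; induction v; simpl; auto; f_equal.
    rewrite <- seq_shift, map_map; auto. }
  apply (computable_ext _ (fun v => a (map (fun g => g v) (map (fun i v => nth i v 0) (seq 1 k))))).
  { intros v L; rewrite E; auto. }
  apply computable_comp.
  - rewrite length_map, length_seq; auto.
  - apply Forall_map, Forall_forall; intros; apply computable_proj.
Qed.

(** The main tool for closure properties: a function is rewritten as a [nat_rect], and its step is
    treated as a function whose first two arguments are the counter and the previous value, as in
    [CPrim]. *)
Lemma computable_rec k (n b : list nat -> nat) (s : nat -> nat -> list nat -> nat) :
  computable k n -> computable k b ->
  computable (S (S k)) (fun w => s (nth 0 w 0) (nth 1 w 0) (tl (tl w))) ->
  computable k (fun v => nat_rect (fun _ => nat) (b v) (fun m r => s m r v) (n v)).
Proof.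
  intros Hn [cb Hb] [cs Hs].
  set (R := fun w => nat_rect (fun _ => nat) (b (tl w)) (fun m r => s m r (tl w)) (hd 0 w)).
  assert (HR : computable (S k) R).
  { exists (CPrim cb cs); intros [|x v] L; [discriminate|]; injection L as L.
    apply (halts_CPrim _ _ _ (fun x => R (x :: v))).
    - apply Hb; auto.
    - intros y; apply (Hs (y :: R (y :: v) :: v)); simpl; auto. }
  assert (E : forall v, length v = k ->
    map (fun g : list nat -> nat => g v) (n :: map (fun i v => nth i v 0) (seq 0 k)) = n v :: v).
  { intros v L; simpl; f_equal; rewrite map_map; subst k.
    clear; induction v; simpl; auto; f_equal.
    rewrite <- seq_shift, map_map; auto. }
  apply (computable_ext _
    (fun v => R (map (fun g => g v) (n :: map (fun i v => nth i v 0) (seq 0 k))))).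
  { intros v L; rewrite E; auto. }
  apply computable_comp.
  - simpl; rewrite length_map, length_seq; auto.
  - constructor; auto; apply Forall_map, Forall_forall; intros; apply computable_proj.
Qed.

Lemma computable_tl2 k a : computable k a -> computable (S (S k)) (fun v => a (tl (tl v))).
Proof. intros H; apply (computable_tl _ (fun v => a (tl v))), computable_tl, H. Qed.

Lemma decidable_tl2 k a : decidable k a -> decidable (S (S k)) (fun v => a (tl (tl v))).
Proof. apply (computable_tl2 k (fun v => Nat.b2n (a v))). Qed.

Lemma computable_nth_tl2 k i : computable (S (S k)) (fun v => nth i (tl (tl v)) 0).
Proof. apply (computable_tl2 k (fun v => nth i v 0)), computable_proj. Qed.

Create HintDb comp discriminated.
#[local] Hint Constants Opaque : comp.
#[local] Hint Resolve computable_const computable_proj computable_S computable_tl2 decidable_tl2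
  computable_nth_tl2 : comp.

Ltac comp := auto 100 with comp nocore.

Lemma computable_if k p a b : decidable k p -> computable k a -> computable k b ->
  computable k (fun v => if p v then a v else b v).
Proof.
  intros Hp Ha Hb.
  apply (computable_ext _ (fun v => nat_rect (fun _ => nat) (b v) (fun _ _ => a v) (Nat.b2n (p v)))).
  { intros v _; destruct (p v); auto. }
  apply (computable_rec k _ b (fun _ _ v => a v)); comp.
Qed.

Lemma computable_add k a b : computable k a -> computable k b -> computable k (fun v => a v + b v).
Proof.
  intros Ha Hb.
  apply (computable_ext _ (fun v => nat_rect (fun _ => nat) (b v) (fun _ r => S r) (a v))).
  { intros v _; induction (a v); simpl; auto. }
  apply (computable_rec k _ b (fun _ r _ => S r)); comp.
Qed.

Lemma computable_pred k a : computable k a -> computable k (fun v => pred (a v)).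
Proof.
  intros Ha.
  apply (computable_ext _ (fun v => nat_rect (fun _ => nat) 0 (fun m _ => m) (a v))).
  { intros v _; destruct (a v); auto. }
  apply (computable_rec k _ (fun _ => 0) (fun m _ _ => m)); comp.
Qed.
#[local] Hint Resolve computable_if computable_add computable_pred : comp.

Lemma computable_mul k a b : computable k a -> computable k b -> computable k (fun v => a v * b v).
Proof.
  intros Ha Hb.
  apply (computable_ext _ (fun v => nat_rect (fun _ => nat) 0 (fun _ r => b v + r) (a v))).
  { intros v _; induction (a v); simpl; auto. }
  apply (computable_rec k _ (fun _ => 0) (fun _ r v => b v + r)); comp.
Qed.

Lemma computable_sub k a b : computable k a -> computable k b -> computable k (fun v => a v - b v).
Proof.
  intros Ha Hb.
  apply (computable_ext _ (fun v => nat_rect (fun _ => nat) (a v) (fun _ r => pred r) (b v))).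
  { intros v _; induction (b v); simpl; lia. }
  apply (computable_rec k _ a (fun _ r _ => pred r)); comp.
Qed.
#[local] Hint Resolve computable_mul computable_sub : comp.

Lemma computable_pow k a b : computable k a -> computable k b -> computable k (fun v => a v ^ b v).
Proof.
  intros Ha Hb.
  apply (computable_ext _ (fun v => nat_rect (fun _ => nat) 1 (fun _ r => a v * r) (b v))).
  { intros v _; induction (b v); simpl; auto. }
  apply (computable_rec k _ (fun _ => 1) (fun _ r v => a v * r)); comp.
Qed.

Lemma decidable_ext k p q : (forall v, p v = q v) -> decidable k p -> decidable k q.
Proof. intros E; apply computable_ext; intros v _; rewrite E; auto. Qed.

Lemma decidable_const k b : decidable k (fun _ => b).
Proof. apply (computable_const k (Nat.b2n b)). Qed.

Lemma decidable_is_zero k a : computable k a -> decidable k (fun v => a v =? 0).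
Proof.
  intros Ha; apply (computable_ext _ (fun v => 1 - a v)); comp.
  intros v _; destruct (a v) as [|[|]]; auto.
Qed.

Lemma decidable_leb k a b : computable k a -> computable k b -> decidable k (fun v => a v <=? b v).
Proof.
  intros Ha Hb; apply (decidable_ext _ (fun v => (a v - b v) =? 0)).
  - intros v; destruct (Nat.leb_spec (a v) (b v)), (Nat.eqb_spec (a v - b v) 0); auto; lia.
  - apply decidable_is_zero; comp.
Qed.

Lemma decidable_ltb k a b : computable k a -> computable k b -> decidable k (fun v => a v <? b v).
Proof. intros Ha Hb; apply (decidable_leb k (fun v => S (a v)) b); comp. Qed.

Lemma decidable_if k p q r : decidable k p -> decidable k q -> decidable k r ->
  decidable k (fun v => if p v then q v else r v).
Proof.
  intros Hp Hq Hr; unfold decidable.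
  apply (computable_ext _ (fun v => if p v then Nat.b2n (q v) else Nat.b2n (r v))).
  - intros v _; destruct (p v); auto.
  - apply computable_if; auto.
Qed.
#[local] Hint Resolve computable_pow decidable_const decidable_is_zero decidable_leb decidable_ltb
  decidable_if : comp.

Lemma decidable_andb k p q : decidable k p -> decidable k q -> decidable k (fun v => p v && q v)%bool.
Proof. intros; apply (decidable_if k p q (fun _ => false)); comp. Qed.

Lemma decidable_orb k p q : decidable k p -> decidable k q -> decidable k (fun v => p v || q v)%bool.
Proof. intros; apply (decidable_if k p (fun _ => true) q); comp. Qed.

Lemma decidable_negb k p : decidable k p -> decidable k (fun v => negb (p v)).
Proof. intros; apply (decidable_if k p (fun _ => false) (fun _ => true)); comp. Qed.
#[local] Hint Resolve decidable_andb decidable_orb decidable_negb : comp.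

Lemma decidable_eqb k a b : computable k a -> computable k b -> decidable k (fun v => a v =? b v).
Proof.
  intros Ha Hb; apply (decidable_ext _ (fun v => (a v <=? b v) && (b v <=? a v))%bool); comp.
  intros v; destruct (Nat.leb_spec (a v) (b v)), (Nat.leb_spec (b v) (a v)),
    (Nat.eqb_spec (a v) (b v)); simpl; auto; lia.
Qed.

Lemma computable_b2n k p : decidable k p -> computable k (fun v => Nat.b2n (p v)).
Proof. auto. Qed.
#[local] Hint Resolve decidable_eqb computable_b2n : comp.

Lemma nat_rect_S b s n :
  nat_rect (fun _ => nat) b s (S n) = s n (nat_rect (fun _ => nat) b s n).
Proof. reflexivity. Qed.

Lemma decidable_even k a : computable k a -> decidable k (fun v => Nat.even (a v)).
Proof.
  intros Ha; unfold decidable.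
  apply (computable_ext _ (fun v => nat_rect (fun _ => nat) 1 (fun _ r => 1 - r) (a v))).
  { intros v _; induction (a v) as [|n IH]; auto.
    rewrite nat_rect_S, IH, Nat.even_succ, <- Nat.negb_even; destruct (Nat.even n); auto. }
  apply (computable_rec k _ (fun _ => 1) (fun _ r _ => 1 - r)); comp.
Qed.
#[local] Hint Resolve decidable_even : comp.

Lemma div2_rec n : n / 2 = nat_rect (fun _ => nat) 0 (fun m r => if Nat.even m then r else S r) n.
Proof.
  induction n as [|n IH]; auto; rewrite nat_rect_S, <- IH, <- !Nat.div2_div.
  destruct (Nat.even n) eqn:E.
  - apply Nat.even_spec in E as [x ->].
    rewrite <- Nat.Even_div2 by (exists x; auto); auto.
  - rewrite <- Nat.negb_odd in E; apply Bool.negb_false_iff, Nat.odd_spec in E.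
    rewrite Nat.Odd_div2; auto.
Qed.

Lemma computable_div2 k a : computable k a -> computable k (fun v => a v / 2).
Proof.
  intros Ha.
  apply (computable_ext _ (fun v => nat_rect (fun _ => nat) 0
    (fun m r => if Nat.even m then r else S r) (a v))).
  { intros v _; rewrite div2_rec; auto. }
  apply (computable_rec k _ (fun _ => 0) (fun m r _ => if Nat.even m then r else S r)); comp.
Qed.

Definition all_below (n : nat) (p : nat -> bool) : bool := forallb p (seq 0 n).
Definition some_below (n : nat) (p : nat -> bool) : bool := negb (all_below n (fun i => negb (p i))).

Lemma all_below_spec n p : all_below n p = true <-> forall i, i < n -> p i = true.
Proof.
  unfold all_below; rewrite forallb_forall; split; intros H i Hi; apply H.
  - apply in_seq; lia.
  - apply in_seq in Hi; lia.
Qed.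

Lemma some_below_spec n p : some_below n p = true <-> exists i, i < n /\ p i = true.
Proof.
  unfold some_below; rewrite Bool.negb_true_iff; split.
  - unfold all_below; intros H.
    destruct (existsb p (seq 0 n)) eqn:E.
    + apply existsb_exists in E as (i & Hi & Hp); exists i; apply in_seq in Hi; split; auto; lia.
    + exfalso; apply Bool.diff_true_false; rewrite <- H; symmetry.
      apply forallb_forall; intros i Hi.
      destruct (p i) eqn:Ep; auto; change (false = true); rewrite <- E; apply existsb_exists; eauto.
  - intros (i & Hi & Hp).
    destruct (all_below n _) eqn:E; auto; rewrite all_below_spec in E.
    specialize (E i Hi); rewrite Hp in E; discriminate.
Qed.

Lemma decidable_all_below k n (p : nat -> list nat -> bool) :
  computable k n -> decidable (S (S k)) (fun w => p (nth 0 w 0) (tl (tl w))) ->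
  decidable k (fun v => all_below (n v) (fun i => p i v)).
Proof.
  intros Hn Hp; unfold decidable.
  apply (computable_ext _ (fun v => nat_rect (fun _ => nat) 1
    (fun m r => if p m v then r else 0) (n v))).
  { intros v _; induction (n v) as [|m IH]; auto.
    rewrite nat_rect_S, IH; unfold all_below; rewrite seq_S, forallb_app; simpl.
    destruct (forallb _ _), (p m v); auto. }
  apply (computable_rec k _ (fun _ => 1) (fun m r v => if p m v then r else 0)); comp.
Qed.

Lemma decidable_some_below k n (p : nat -> list nat -> bool) :
  computable k n -> decidable (S (S k)) (fun w => p (nth 0 w 0) (tl (tl w))) ->
  decidable k (fun v => some_below (n v) (fun i => p i v)).
Proof.
  intros Hn Hp; apply decidable_negb, (decidable_all_below k n (fun i v => negb (p i v))); comp.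
Qed.
#[local] Hint Resolve computable_div2 decidable_all_below decidable_some_below : comp.

(** * Pairing *)

(** [unpair] runs through the diagonals a + b = s one after another, each by increasing b; [tri s]
    is the index at which diagonal s starts. *)
Definition tri (n : nat) : nat := nat_rect (fun _ => nat) 0 (fun m r => S m + r) n.
Definition npair (a b : nat) : nat := tri (a + b) + b.
Definition pi1 (o : nat) : nat := fst (unpair o).
Definition pi2 (o : nat) : nat := snd (unpair o).

(* The diagonal [a + b] of the [o]-th pair [(a, b)]. *)
Definition diag (o : nat) : nat :=
  nat_rect (fun _ => nat) 0 (fun m r => if m =? tri r + r then S r else r) o.

Lemma unpair_S o : unpair (S o) =
  let (a, b) := unpair o in match a with O => (S b, 0) | S a' => (a', S b) end.
Proof. reflexivity. Qed.

(** [unpair] recurses on pairs, whereas [computable_rec] carries a single number. The number a + b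
    can be followed by such a recursion, and both components are recovered from it by
    subtraction. *)
Lemma unpair_diag o : diag o = pi1 o + pi2 o /\ o = tri (diag o) + pi2 o.
Proof.
  induction o as [|o [IH1 IH2]]; [split; reflexivity|].
  unfold pi1, pi2 in *; simpl unpair; simpl diag; fold (diag o).
  destruct (unpair o) as [a b]; simpl in IH1, IH2.
  destruct (Nat.eqb_spec o (tri (diag o) + diag o)) as [E|E]; destruct a as [|a]; simpl; lia.
Qed.

Lemma unpair_pair a b : unpair (npair a b) = (a, b).
Proof.
  (* Induction on the diagonal, then on the position in it. *)
  assert (G : forall s b, b <= s -> unpair (tri s + b) = (s - b, b)).
  { induction s as [|s IHs].
    - intros b' L; replace b' with 0 by lia; reflexivity.
    - intros b'; induction b' as [|b' IHb]; intros L.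
      + replace (tri (S s) + 0) with (S (tri s + s)) by (simpl; lia).
        rewrite unpair_S, IHs by lia; rewrite Nat.sub_diag; auto.
      + rewrite Nat.add_succ_r, unpair_S, IHb by lia.
        destruct (S s - b') eqn:E; [lia|]; f_equal; lia. }
  unfold npair; rewrite G by lia; f_equal; lia.
Qed.

Lemma pi1_pair a b : pi1 (npair a b) = a.
Proof. unfold pi1; rewrite unpair_pair; auto. Qed.

Lemma pi2_pair a b : pi2 (npair a b) = b.
Proof. unfold pi2; rewrite unpair_pair; auto. Qed.

Lemma le_tri n : n <= tri n.
Proof. induction n; simpl; lia. Qed.

Lemma pi1_le o : pi1 o <= o.
Proof. destruct (unpair_diag o); pose proof (le_tri (diag o)); lia. Qed.

Lemma pi2_le o : pi2 o <= o.
Proof. destruct (unpair_diag o); lia. Qed.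

Lemma computable_tri k a : computable k a -> computable k (fun v => tri (a v)).
Proof. intros; apply (computable_rec k _ (fun _ => 0) (fun m r _ => S m + r)); comp. Qed.

#[local] Hint Resolve computable_tri : comp.

Lemma computable_pair k a b : computable k a -> computable k b -> computable k (fun v => npair (a v) (b v)).
Proof. intros; unfold npair; comp. Qed.

Lemma computable_diag k a : computable k a -> computable k (fun v => diag (a v)).
Proof.
  intros; apply (computable_rec k _ (fun _ => 0) (fun m r _ => if m =? tri r + r then S r else r)); comp.
Qed.
#[local] Hint Resolve computable_pair computable_diag : comp.

Lemma computable_pi2 k a : computable k a -> computable k (fun v => pi2 (a v)).
Proof.
  intros; apply (computable_ext _ (fun v => a v - tri (diag (a v)))); comp.
  intros v _; destruct (unpair_diag (a v)); lia.
Qed.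
#[local] Hint Resolve computable_pi2 : comp.

Lemma computable_pi1 k a : computable k a -> computable k (fun v => pi1 (a v)).
Proof.
  intros; apply (computable_ext _ (fun v => diag (a v) - pi2 (a v))); comp.
  intros v _; destruct (unpair_diag (a v)); lia.
Qed.
#[local] Hint Resolve computable_pi1 : comp.

Opaque npair pi1 pi2.

(** * A universal machine *)

(** The empty list is 0, on which [hd_code] and [tl_code] return 0, in accordance with [hd 0] and
    [tl]. *)
Definition cons_code (a l : nat) : nat := S (npair a l).
Definition hd_code (l : nat) : nat := pi1 (pred l).
Definition tl_code (l : nat) : nat := pi2 (pred l).
Definition drop_code (i l : nat) : nat := nat_rect (fun _ => nat) l (fun _ r => tl_code r) i.

Fixpoint list_code (l : list nat) : nat :=
  match l with [] => 0 | a :: l' => cons_code a (list_code l') end.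

Lemma hd_cons_code a l : hd_code (cons_code a l) = a.
Proof. apply pi1_pair. Qed.

Lemma tl_cons_code a l : tl_code (cons_code a l) = l.
Proof. apply pi2_pair. Qed.

Lemma hd_list_code l : hd_code (list_code l) = hd 0 l.
Proof. destruct l; [reflexivity|apply hd_cons_code]. Qed.

Lemma tl_list_code l : tl_code (list_code l) = list_code (tl l).
Proof. destruct l; [reflexivity|apply tl_cons_code]. Qed.

Lemma drop_list_code i l : hd_code (drop_code i (list_code l)) = nth i l 0.
Proof.
  assert (G : forall i l, drop_code i (list_code l) = list_code (skipn i l)).
  { clear; induction i as [|i IH]; intros l; [destruct l; reflexivity|].
    unfold drop_code in *; rewrite nat_rect_S, IH, tl_list_code.
    f_equal; revert l; clear; induction i as [|i IH]; intros [|a l]; auto.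
    apply (IH l). }
  rewrite G, hd_list_code; revert l; induction i as [|i IH]; intros [|a l]; auto.
  apply (IH l).
Qed.

Definition quad (a b c d : nat) : nat := npair a (npair b (npair c d)).
Definition quad1 (s : nat) : nat := pi1 s.
Definition quad2 (s : nat) : nat := pi1 (pi2 s).
Definition quad3 (s : nat) : nat := pi1 (pi2 (pi2 s)).
Definition quad4 (s : nat) : nat := pi2 (pi2 (pi2 s)).

(* A configuration is [quad mode x y stack]: mode 0 returns the value [x]; mode 1 evaluates the
   program [x] on the arguments [y]; mode 2 has [x] = (function, reversed list of the remaining
   argument programs) and [y] = (arguments, values computed so far). A stack frame is
   [quad tag _ _ _], with tag 0 for a composition, 1 for a recursion and 2 for a search. *)
Definition return_step (s o stack frame rest : nat) : nat :=
  if stack =? 0 then s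
  else if quad1 frame =? 0 then
    quad 2 (quad2 frame) (npair (quad3 frame) (cons_code o (quad4 frame))) rest
  else if quad1 frame =? 1 then
    quad 1 (quad2 frame) (cons_code (quad3 frame) (cons_code o (quad4 frame))) rest
  else if o =? 0 then quad 0 (quad3 frame) 0 rest
  else quad 1 (quad2 frame) (cons_code (S (quad3 frame)) (quad4 frame))
         (cons_code (quad 2 (quad2 frame) (S (quad3 frame)) (quad4 frame)) rest).

(** One case per constructor, with the tags of [goedel]. A recursion first evaluates itself at the
    predecessor, leaving its step program on the stack; a search starts with the trial 0. *)
Definition eval_step (c tag body v stack : nat) : nat :=
  if tag =? 0 then quad 0 0 0 stack
  else if tag =? 1 then quad 0 (S (hd_code v)) 0 stack
  else if tag =? 2 then quad 0 (hd_code (drop_code body v)) 0 stack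
  else if tag =? 3 then quad 2 body (npair v 0) stack
  else if tag =? 4 then
    if hd_code v =? 0 then quad 1 (pi1 body) (tl_code v) stack
    else quad 1 c (cons_code (pred (hd_code v)) (tl_code v))
           (cons_code (quad 1 (pi2 body) (pred (hd_code v)) (tl_code v)) stack)
  else quad 1 body (cons_code 0 v) (cons_code (quad 2 body 0 v) stack).

Definition args_step (f gs v acc stack : nat) : nat :=
  if gs =? 0 then quad 1 f acc stack
  else quad 1 (hd_code gs) v (cons_code (quad 0 (npair f (tl_code gs)) v acc) stack).

Definition step (s : nat) : nat :=
  if quad1 s =? 0 then return_step s (quad2 s) (quad4 s) (hd_code (quad4 s)) (tl_code (quad4 s))
  else if quad1 s =? 1 then eval_step (quad2 s) (pi1 (quad2 s)) (pi2 (quad2 s)) (quad3 s) (quad4 s)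
  else args_step (pi1 (quad2 s)) (pi2 (quad2 s)) (pi1 (quad3 s)) (pi2 (quad3 s)) (quad4 s).

Definition run (t s : nat) : nat := nat_rect (fun _ => nat) s (fun _ r => step r) t.

(** The argument programs are stored in reverse: evaluating the last one first and consing the
    values gives the argument list in the right order. *)
Fixpoint goedel (c : code) : nat :=
  match c with
  | CZero => npair 0 0
  | CSucc => npair 1 0
  | CProj i => npair 2 i
  | CComp f gs => npair 3 (npair (goedel f) (list_code (rev (map goedel gs))))
  | CPrim f g => npair 4 (npair (goedel f) (goedel g))
  | CMu f => npair 5 (goedel f)
  end.

Lemma quad1_quad a b c d : quad1 (quad a b c d) = a.
Proof. apply pi1_pair. Qed.
Lemma quad2_quad a b c d : quad2 (quad a b c d) = b.
Proof. unfold quad2, quad; rewrite pi2_pair, pi1_pair; auto. Qed.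
Lemma quad3_quad a b c d : quad3 (quad a b c d) = c.
Proof. unfold quad3, quad; rewrite !pi2_pair, pi1_pair; auto. Qed.
Lemma quad4_quad a b c d : quad4 (quad a b c d) = d.
Proof. unfold quad4, quad; rewrite !pi2_pair; auto. Qed.

Opaque quad quad1 quad2 quad3 quad4.

Lemma run_S t s : run (S t) s = step (run t s).
Proof. reflexivity. Qed.

Lemma run_add t t' s : run (t + t') s = run t (run t' s).
Proof. induction t as [|t IH]; auto; simpl Nat.add; rewrite !run_S, IH; auto. Qed.

Definition reaches (s s' : nat) : Prop := exists t, run t s = s'.

Lemma reaches_refl s : reaches s s.
Proof. exists 0; auto. Qed.

Lemma reaches_trans s s' s'' : reaches s s' -> reaches s' s'' -> reaches s s''.
Proof. intros [t <-] [t' <-]; exists (t' + t); apply run_add. Qed.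

Lemma reaches_step s s' : reaches (step s) s' -> reaches s s'.
Proof. apply reaches_trans; exists 1; auto. Qed.

Ltac decode := rewrite ?quad1_quad, ?quad2_quad, ?quad3_quad, ?quad4_quad, ?hd_cons_code,
  ?tl_cons_code, ?hd_list_code, ?tl_list_code, ?drop_list_code, ?pi1_pair, ?pi2_pair; simpl Nat.eqb;
  cbv iota beta.
Ltac mstep := apply reaches_step; unfold step at 1; decode;
  unfold return_step, eval_step, args_step; decode.

(** The generalisation over [rest] serves the induction: since the list is reversed, the head of
    [gs] is reached after its tail and joins [rest] in the inductive hypothesis. *)
Lemma reaches_evals f v (ev : code -> option nat) gs w acc rest stack :
  (forall g o stack, ev g = Some o -> reaches (quad 1 (goedel g) v stack) (quad 0 o 0 stack)) ->
  evals ev gs = Some w ->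
  reaches (quad 2 (npair f (list_code (rev (map goedel gs) ++ rest))) (npair v (list_code acc)) stack)
          (quad 2 (npair f (list_code rest)) (npair v (list_code (w ++ acc))) stack).
Proof.
  intros H; revert w rest; induction gs as [|g gs IH]; simpl; intros w rest.
  - intros [= <-]; apply reaches_refl.
  - destruct (ev g) as [a|] eqn:E; [|discriminate].
    destruct (evals ev gs) as [w'|]; [|discriminate]; intros [= <-].
    rewrite <- app_assoc; eapply reaches_trans; [apply IH; auto|].
    simpl list_code; mstep; eapply reaches_trans; [apply H; eauto|].
    mstep; apply reaches_refl.
Qed.

(** Induction on the fuel for every stack, so that a subcomputation can run above the frames of its
    caller. *)
Lemma reaches_eval k c v o stack : eval k c v = Some o ->
  reaches (quad 1 (goedel c) (list_code v) stack) (quad 0 o 0 stack).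
Proof.
  revert c v o stack; induction k as [|k IH]; intros c v o stack; [discriminate|].
  destruct c.
  - intros [= <-]; simpl goedel; mstep; apply reaches_refl.
  - intros [= <-]; simpl goedel; mstep; apply reaches_refl.
  - intros [= <-]; simpl goedel; mstep; apply reaches_refl.
  - rewrite eval_CComp; destruct (evals _ gs) as [w|] eqn:E; [|discriminate]; intros H.
    simpl goedel; mstep.
    rewrite <- (app_nil_r (rev _)).
    eapply reaches_trans.
    { apply (reaches_evals _ _ _ _ _ []) with (2 := E); intros; apply IH; auto. }
    rewrite app_nil_r; mstep; apply IH; auto.
  - rewrite eval_CPrim; intros H; simpl goedel; mstep.
    destruct (hd 0 v) as [|x] eqn:Ev; simpl Nat.eqb; cbv iota.
    + apply IH; auto.
    + destruct (eval k (CPrim c1 c2) (x :: tl v)) as [r|] eqn:E; [|discriminate].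
      simpl pred.
      eapply reaches_trans; [apply (IH (CPrim c1 c2) (x :: tl v)); eauto|].
      mstep; apply (IH c2 (x :: r :: tl v)); auto.
  - rewrite eval_CMu; intros H; simpl goedel; mstep.
    assert (G : forall fuel i, search (fun i => eval k c (i :: v)) i fuel = Some o ->
      reaches (quad 1 (goedel c) (cons_code i (list_code v))
        (cons_code (quad 2 (goedel c) i (list_code v)) stack)) (quad 0 o 0 stack)).
    { clear H; induction fuel as [|fu IHf]; simpl; intros i; [discriminate|].
      destruct (eval k c (i :: v)) as [x|] eqn:E; [|discriminate]; intros H.
      eapply reaches_trans; [apply (IH c (i :: v)); eauto|].
      destruct x as [|x].
      - injection H as <-; mstep; apply reaches_refl.
      - mstep; apply IHf; auto. }
    apply (G _ _ H).
Qed.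

(* [S o] when the program with number [e], run for [t] steps on the arguments [x, n], has returned
   [o]; [0] while it is still running. *)
Definition universal (t e x n : nat) : nat :=
  let s := run t (quad 1 e (cons_code x (cons_code n 0)) 0) in
  if ((quad1 s =? 0) && (quad4 s =? 0))%bool then S (quad2 s) else 0.

(** A configuration that returns a value to the empty stack is a fixed point of [step]. *)
Lemma universal_le t t' e x n o : t <= t' -> universal t e x n = S o -> universal t' e x n = S o.
Proof.
  induction 1 as [|t' _ IH]; auto; intros H; specialize (IH H); clear H.
  unfold universal in *; rewrite run_S.
  set (s := run t' _) in *; clearbody s; unfold step, return_step; cbv zeta in *.
  destruct (quad1 s =? 0) eqn:E1, (quad4 s =? 0) eqn:E4; simpl in IH; try discriminate.
  rewrite E1, E4; auto.
Qed.

Lemma universal_complete c x n o : halts_with c [x; n] o ->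
  exists t0, forall t, t0 <= t -> universal t (goedel c) x n = S o.
Proof.
  intros [k H]; apply (reaches_eval _ _ _ _ 0) in H as [t0 H]; exists t0; intros t L.
  apply (universal_le t0); auto; unfold universal; simpl list_code in H; rewrite H; decode; auto.
Qed.

Transparent quad quad1 quad2 quad3 quad4.

Lemma computable_quad k a b c d : computable k a -> computable k b -> computable k c ->
  computable k d -> computable k (fun v => quad (a v) (b v) (c v) (d v)).
Proof. intros; unfold quad; comp. Qed.

Lemma computable_quad1 k a : computable k a -> computable k (fun v => quad1 (a v)).
Proof. intros; unfold quad1; comp. Qed.
Lemma computable_quad2 k a : computable k a -> computable k (fun v => quad2 (a v)).
Proof. intros; unfold quad2; comp. Qed.
Lemma computable_quad3 k a : computable k a -> computable k (fun v => quad3 (a v)).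
Proof. intros; unfold quad3; comp. Qed.
Lemma computable_quad4 k a : computable k a -> computable k (fun v => quad4 (a v)).
Proof. intros; unfold quad4; comp. Qed.

Opaque quad quad1 quad2 quad3 quad4.

Lemma computable_cons_code k a l : computable k a -> computable k l ->
  computable k (fun v => cons_code (a v) (l v)).
Proof. intros; unfold cons_code; comp. Qed.
Lemma computable_hd_code k l : computable k l -> computable k (fun v => hd_code (l v)).
Proof. intros; unfold hd_code; comp. Qed.
Lemma computable_tl_code k l : computable k l -> computable k (fun v => tl_code (l v)).
Proof. intros; unfold tl_code; comp. Qed.
#[local] Hint Resolve computable_quad computable_quad1 computable_quad2 computable_quad3 computable_quad4
  computable_cons_code computable_hd_code computable_tl_code : comp.

Lemma computable_drop_code k i l : computable k i -> computable k l ->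
  computable k (fun v => drop_code (i v) (l v)).
Proof. intros; apply (computable_rec k _ l (fun _ r _ => tl_code r)); comp. Qed.
#[local] Hint Resolve computable_drop_code : comp.

Lemma computable_step k s : computable k s -> computable k (fun v => step (s v)).
Proof. intros; unfold step, return_step, eval_step, args_step; comp. Qed.
#[local] Hint Resolve computable_step : comp.

Lemma computable_run k t s : computable k t -> computable k s ->
  computable k (fun v => run (t v) (s v)).
Proof. intros; apply (computable_rec k _ s (fun _ r _ => step r)); comp. Qed.
#[local] Hint Resolve computable_run : comp.

Lemma computable_universal k t e x n : computable k t -> computable k e -> computable k x ->
  computable k n -> computable k (fun v => universal (t v) (e v) (x v) (n v)).
Proof. intros; unfold universal; cbv zeta; comp. Qed.
#[local] Hint Resolve computable_universal : comp.

(** * Strings as numbers *)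

(** The first bit of a string is the last to enter its code: [pred s / 2] removes it, and it is 1
    exactly when the nonzero code is even. Beyond the end the bits read as 0, so [bit s] is the
    infinite sequence that continues the string with zeros; this is how a number denotes an atom. *)
Definition drop_bits (i s : nat) : nat := nat_rect (fun _ => nat) s (fun _ r => pred r / 2) i.
Definition bit (s i : nat) : bool := negb (drop_bits i s =? 0) && Nat.even (drop_bits i s).
Definition strlen (s : nat) : nat :=
  nat_rect (fun _ => nat) 0 (fun i r => r + Nat.b2n (negb (drop_bits i s =? 0))) s.
Definition prefix_code (s i : nat) : nat :=
  nat_rect (fun _ => nat) 0 (fun k r => r + 2 ^ k * S (Nat.b2n (bit s k))) i.

Lemma strcode_cons b l : strcode (b :: l) = S (2 * strcode l + Nat.b2n b).
Proof. destruct b; simpl; lia. Qed.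

Lemma tl_strcode l : pred (strcode l) / 2 = strcode (tl l).
Proof.
  destruct l as [|b l]; [reflexivity|].
  rewrite strcode_cons; simpl pred; simpl tl.
  symmetry; apply (Nat.div_unique _ _ _ (Nat.b2n b)); destruct b; simpl; lia.
Qed.

Lemma drop_bits_strcode i l : drop_bits i (strcode l) = strcode (skipn i l).
Proof.
  induction i as [|i IH]; [reflexivity|].
  unfold drop_bits in *; rewrite nat_rect_S, IH, tl_strcode; f_equal.
  clear IH; revert l; induction i as [|i IH]; intros [|b l]; auto; apply (IH l).
Qed.

Lemma bit_strcode l i : bit (strcode l) i = nth i l false.
Proof.
  unfold bit; rewrite drop_bits_strcode.
  revert l; induction i as [|i IH]; intros [|b l]; auto; [|apply (IH l)].
  simpl skipn; rewrite strcode_cons; simpl negb; simpl nth.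
  rewrite Nat.even_succ, Nat.add_comm, Nat.odd_add_mul_2; destruct b; auto.
Qed.

Lemma bit_0 i : bit 0 i = false.
Proof. change 0 with (strcode []) at 1; rewrite bit_strcode; destruct i; auto. Qed.

Lemma length_le_strcode l : length l <= strcode l.
Proof. induction l as [|b l IH]; [simpl; lia|]; rewrite strcode_cons; simpl length; lia. Qed.

Lemma strlen_strcode l : strlen (strcode l) = length l.
Proof.
  unfold strlen.
  assert (G : forall n, nat_rect (fun _ => nat) 0
    (fun i r => r + Nat.b2n (negb (drop_bits i (strcode l) =? 0))) n = Nat.min n (length l)).
  { induction n as [|n IH]; auto; rewrite nat_rect_S, IH, drop_bits_strcode.
    destruct (Nat.le_gt_cases (length l) n) as [L|L].
    - rewrite skipn_all2 by auto; simpl Nat.b2n; lia.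
    - pose proof (length_le_strcode (skipn n l)) as K; rewrite length_skipn in K.
      destruct (Nat.eqb_spec (strcode (skipn n l)) 0); simpl Nat.b2n; lia. }
  rewrite G; pose proof (length_le_strcode l); lia.
Qed.

Lemma strcode_inj l l' : strcode l = strcode l' -> l = l'.
Proof.
  intros E; apply (nth_ext _ _ false false).
  - rewrite <- !strlen_strcode, E; auto.
  - intros i _; rewrite <- !bit_strcode, E; auto.
Qed.

Lemma strcode_app l l' : strcode (l ++ l') = strcode l + 2 ^ length l * strcode l'.
Proof.
  induction l as [|b l IH]; [simpl; lia|].
  rewrite <- app_comm_cons, !strcode_cons, IH; simpl length; rewrite Nat.pow_succ_r'; lia.
Qed.

Lemma length_prefix X n : length (prefix X n) = n.
Proof. unfold prefix; rewrite length_map, length_seq; auto. Qed.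

Lemma prefix_S X n : prefix X (S n) = prefix X n ++ [X n].
Proof. unfold prefix; rewrite seq_S, map_app; auto. Qed.

Lemma prefix_add X n k : prefix X (n + k) = prefix X n ++ map X (seq n k).
Proof. unfold prefix; rewrite seq_app, map_app; auto. Qed.

Lemma nth_prefix X n i : i < n -> nth i (prefix X n) false = X i.
Proof.
  intros L; unfold prefix; rewrite (nth_indep _ _ (X 0)) by (rewrite length_map, length_seq; auto).
  rewrite map_nth, seq_nth; auto.
Qed.

Lemma prefix_ext X Y n : (forall i, i < n -> X i = Y i) -> prefix X n = prefix Y n.
Proof. intros H; apply map_ext_in; intros i Hi; apply H; apply in_seq in Hi; lia. Qed.

Lemma prefix_eq X Y n : prefix X n = prefix Y n -> forall i, i < n -> X i = Y i.
Proof. intros E i L; rewrite <- (nth_prefix X n i L), E; apply nth_prefix; auto. Qed.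

Lemma prefix_nth l : prefix (fun i => nth i l false) (length l) = l.
Proof.
  apply (nth_ext _ _ false false).
  - apply length_prefix.
  - intros i; rewrite length_prefix; apply nth_prefix.
Qed.

Lemma strcode_prefix s i : strcode (prefix (bit s) i) = prefix_code s i.
Proof.
  induction i as [|i IH]; [reflexivity|].
  rewrite prefix_S, strcode_app, IH, length_prefix; unfold prefix_code; rewrite nat_rect_S.
  destruct (bit s i); reflexivity.
Qed.

Lemma computable_drop_bits k i s : computable k i -> computable k s ->
  computable k (fun v => drop_bits (i v) (s v)).
Proof. intros; apply (computable_rec k _ s (fun _ r _ => pred r / 2)); comp. Qed.
#[local] Hint Resolve computable_drop_bits : comp.

Lemma decidable_bit k s i : computable k s -> computable k i ->
  decidable k (fun v => bit (s v) (i v)).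
Proof. intros; unfold bit; comp. Qed.
#[local] Hint Resolve decidable_bit : comp.

Lemma computable_strlen k s : computable k s -> computable k (fun v => strlen (s v)).
Proof.
  intros; apply (computable_rec k _ (fun _ => 0)
    (fun i r v => r + Nat.b2n (negb (drop_bits i (s v) =? 0)))); comp.
Qed.

Lemma computable_prefix_code k s i : computable k s -> computable k i ->
  computable k (fun v => prefix_code (s v) (i v)).
Proof.
  intros; apply (computable_rec k _ (fun _ => 0)
    (fun i r v => r + 2 ^ i * S (Nat.b2n (bit (s v) i)))); comp.
Qed.
#[local] Hint Resolve computable_strlen computable_prefix_code : comp.

(** * The atoms *)

(** Negative rationals are truncated to 0, so that values can be compared within the natural
    numbers. *)
Definition numerator (o : nat) : nat := if Nat.even (pi1 o) then pi1 o / 2 else 0.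
Definition denominator (o : nat) : nat := S (pi2 o).

(* With [q o = numerator o / denominator o], this says [q o' + 2 / 2 ^ m < q o]. *)
Definition exceeds (m o o' : nat) : bool :=
  (numerator o' * 2 ^ m + 2 * denominator o') * denominator o <?
  numerator o * denominator o' * 2 ^ m.

(* [p] is the code of a string of length [2 * m] and [c] the code of a string appended to it;
   the strings 1, 10, 11 have codes 2, 4, 6. *)
Definition extend (p m c : nat) : nat := p + 2 ^ (2 * m) * c.

Definition active (p e : nat) : bool := bit p (2 * e + 1).

Definition halted (t e x n : nat) : bool := negb (universal t e x n =? 0).

Definition converges (t p m : nat) : bool :=
  all_below m (fun e => negb (active p e) ||
    (halted t e p m && halted t e (extend p m 2) m &&
     halted t e (extend p m 4) m && halted t e (extend p m 6) m)).

(** [pred] turns the output of [universal] into the returned value. The verdict is consulted only at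
    stages where [converges] holds, and there it does not depend on the stage. *)
Definition violates (t p m c : nat) : bool :=
  some_below m (fun e => active p e &&
    exceeds m (pred (universal t e (extend p m c) m)) (pred (universal t e p m))).

Definition target (t p m : nat) : nat :=
  if violates t p m 2 then extend p m 2
  else if violates t p m 4 then extend p m 4
  else if violates t p m 6 then extend p m 6
  else p.

Definition violated (t p m : nat) : bool :=
  violates t p m 2 || violates t p m 4 || violates t p m 6.

(** A violated shorter prefix rules [y] out, since all the mass of that prefix has to go to its
    target. The even bits 1 separate guesses from the zeros that follow: the atom p000... leaves
    every longer path right after p. *)
Definition live (t y m : nat) : bool :=
  converges t (prefix_code y (2 * m)) m &&
  all_below m (fun i => bit y (2 * i) && converges t (prefix_code y (2 * i)) i &&
                        negb (violated t (prefix_code y (2 * i)) i)).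

(** The default 0 is the sequence 000..., which is off the path from the first bit on; indices that
    are not live put their weight there, which keeps the total mass 1. *)
Definition atom_at (t y m : nat) : nat :=
  if live t y m then target t (prefix_code y (2 * m)) m else 0.

(** The index [j] codes the triple of string [y], level [m] and stage [t]. The components of a pair
    are at most its code, so [m <= j]: atoms of high level have small weight. *)
Definition atom (j : nat) : nat := atom_at (pi2 (pi2 j)) (pi1 j) (pi1 (pi2 j)).

Definition meets (s j : nat) : bool := s =? prefix_code (atom j) (strlen s).

Lemma meets_spec l j : meets (strcode l) j = true <-> l = prefix (bit (atom j)) (length l).
Proof.
  unfold meets; rewrite Nat.eqb_eq, strlen_strcode, <- strcode_prefix; split; intros E.
  - apply strcode_inj; auto.
  - rewrite <- E; auto.
Qed.

Lemma decidable_exceeds k m o o' : computable k m -> computable k o -> computable k o' ->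
  decidable k (fun v => exceeds (m v) (o v) (o' v)).
Proof. intros; unfold exceeds, numerator, denominator; comp. Qed.

Lemma decidable_halted k t e x n : computable k t -> computable k e -> computable k x ->
  computable k n -> decidable k (fun v => halted (t v) (e v) (x v) (n v)).
Proof. intros; unfold halted; comp. Qed.

Lemma computable_extend k p m c : computable k p -> computable k m -> computable k c ->
  computable k (fun v => extend (p v) (m v) (c v)).
Proof. intros; unfold extend; comp. Qed.
#[local] Hint Resolve decidable_exceeds decidable_halted computable_extend : comp.

Lemma decidable_converges k t p m : computable k t -> computable k p -> computable k m ->
  decidable k (fun v => converges (t v) (p v) (m v)).
Proof.
  intros; unfold converges, active; comp.
Qed.

Lemma decidable_violates k t p m c : computable k t -> computable k p -> computable k m ->
  decidable k (fun v => violates (t v) (p v) (m v) c).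
Proof.
  intros; unfold violates, active; comp.
Qed.
#[local] Hint Resolve decidable_converges decidable_violates : comp.

Lemma decidable_live k t y m : computable k t -> computable k y -> computable k m ->
  decidable k (fun v => live (t v) (y v) (m v)).
Proof.
  intros; unfold live, violated; comp.
Qed.
#[local] Hint Resolve decidable_live : comp.

Lemma computable_atom k j : computable k j -> computable k (fun v => atom (j v)).
Proof. intros; unfold atom, atom_at, target; comp. Qed.
#[local] Hint Resolve computable_atom : comp.

Lemma decidable_meets k s j : computable k s -> computable k j ->
  decidable k (fun v => meets (s v) (j v)).
Proof. intros; unfold meets; comp. Qed.
#[local] Hint Resolve decidable_meets : comp.

(** * The path of correct guesses *)

Definition eventually (Q : nat -> Prop) : Prop := exists t0, forall t, t0 <= t -> Q t.

Lemma eventually_and Q Q' : eventually Q -> eventually Q' -> eventually (fun t => Q t /\ Q' t).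
Proof. intros [t H] [t' H']; exists (t + t'); intros s L; split; [apply H|apply H']; lia. Qed.

Lemma eventually_mono (Q Q' : nat -> Prop) : (forall t, Q t -> Q' t) -> eventually Q -> eventually Q'.
Proof. intros H [t0 H0]; exists t0; auto. Qed.

Lemma eventually_below n (Q : nat -> nat -> Prop) :
  (forall i, i < n -> eventually (Q i)) -> eventually (fun t => forall i, i < n -> Q i t).
Proof.
  induction n as [|n IH]; intros H; [exists 0; intros; lia|].
  destruct IH as [t1 H1]; [auto|]; destruct (H n) as [t2 H2]; [lia|].
  exists (t1 + t2); intros t L i Li; destruct (Nat.eq_dec i n) as [->|]; [apply H2|apply H1]; lia.
Qed.

Lemma halted_S t e x n : halted t e x n = true <-> exists o, universal t e x n = S o.
Proof.
  unfold halted; destruct (universal t e x n) as [|o]; simpl; split; intros H; auto.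
  - discriminate.
  - destruct H; discriminate.
  - exists o; auto.
Qed.

Lemma converges_spec t p m : converges t p m = true <->
  forall e, e < m -> active p e = true -> halted t e p m = true /\
    forall c, In c [2; 4; 6] -> halted t e (extend p m c) m = true.
Proof.
  unfold converges; rewrite all_below_spec; split; intros H e L.
  - intros Ha; specialize (H e L); rewrite Ha in H; simpl in H.
    rewrite !andb_true_iff in H; destruct H as [[[H H2] H4] H6]; split; auto.
    intros c [<-|[<-|[<-|[]]]]; auto.
  - destruct (active p e) eqn:Ha; auto; destruct (H e L Ha) as [H0 H1].
    rewrite H0, !H1 by (simpl; auto); auto.
Qed.

Lemma universal_stable t t' e x n : halted t e x n = true -> halted t' e x n = true ->
  universal t e x n = universal t' e x n.
Proof.
  intros [o H]%halted_S [o' H']%halted_S; rewrite H, H'.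
  apply (universal_le t (t + t')) in H; [|lia].
  apply (universal_le t' (t + t')) in H'; [|lia]; congruence.
Qed.

Lemma some_below_ext n p q : (forall i, i < n -> p i = q i) -> some_below n p = some_below n q.
Proof.
  intros H; apply eq_true_iff_eq; rewrite !some_below_spec.
  split; intros (i & L & E); exists i; rewrite H in * by auto; auto.
Qed.

(** All the values being compared have been returned at both stages, and a returned value never
    changes. *)
Lemma violates_stable t t' p m c : In c [2; 4; 6] ->
  converges t p m = true -> converges t' p m = true -> violates t p m c = violates t' p m c.
Proof.
  rewrite !converges_spec; intros Hc H H'; apply some_below_ext; intros e L.
  destruct (active p e) eqn:Ha; auto; simpl.
  destruct (H e L Ha) as [H0 H1], (H' e L Ha) as [H0' H1'].
  rewrite (universal_stable t t' e p m), (universal_stable t t' e (extend p m c) m); auto.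
Qed.

Lemma target_stable t t' p m : converges t p m = true -> converges t' p m = true ->
  target t p m = target t' p m /\ violated t p m = violated t' p m.
Proof.
  intros H H'; unfold target, violated.
  rewrite !(fun c Hc => violates_stable t t' p m c Hc H H') by (simpl; auto); auto.
Qed.

Lemma target_violated t p m : violated t p m = true ->
  exists c, In c [2; 4; 6] /\ target t p m = extend p m c /\ violates t p m c = true.
Proof.
  unfold violated, target; destruct (violates t p m 2) eqn:E2; [exists 2; simpl; auto|].
  destruct (violates t p m 4) eqn:E4; [exists 4; simpl; auto|].
  destruct (violates t p m 6) eqn:E6; [exists 6; simpl; auto 6|discriminate].
Qed.

Lemma target_not_violated t p m : violated t p m = false -> target t p m = p.
Proof.
  unfold violated, target; destruct (violates t p m 2), (violates t p m 4), (violates t p m 6);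
    simpl; intros; auto; discriminate.
Qed.

Lemma violated_false t p m c : violated t p m = false -> In c [2; 4; 6] -> violates t p m c = false.
Proof.
  unfold violated; rewrite !orb_false_iff; intros [[? ?] ?] [<-|[<-|[<-|[]]]]; auto.
Qed.

Lemma extend_strcode l m w : length l = 2 * m -> extend (strcode l) m (strcode w) = strcode (l ++ w).
Proof. intros E; rewrite strcode_app, E; auto. Qed.

Lemma code_cases c : In c [2; 4; 6] ->
  exists w, c = strcode w /\ In w [[true]; [true; false]; [true; true]].
Proof.
  intros [<-|[<-|[<-|[]]]]; [exists [true]|exists [true; false]|exists [true; true]];
    simpl; auto.
Qed.

Lemma target_extends t l m : length l = 2 * m -> exists w, target t (strcode l) m = strcode (l ++ w).
Proof.
  intros L; destruct (violated t (strcode l) m) eqn:E.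
  - destruct (target_violated _ _ _ E) as (c & Hc & -> & _).
    destruct (code_cases c Hc) as (w & -> & _); exists w; apply extend_strcode; auto.
  - exists []; rewrite target_not_violated, app_nil_r; auto.
Qed.

(* The even bits of a path of guesses are 1; its bit [2 * e + 1] guesses whether the program
   with number [e] computes a total martingale. *)
Definition node (X : nat -> bool) (m : nat) : list bool := prefix X (2 * m).

(** What the combinatorics of atoms needs to know of the path: every program it guesses to be total
    halts on all inputs. *)
Definition admissible (X : nat -> bool) : Prop :=
  (forall m, X (2 * m) = true) /\
  (forall e, X (2 * e + 1) = true -> forall x n, eventually (fun t => halted t e x n = true)).

Definition unviolated (X : nat -> bool) (m : nat) : Prop :=
  forall t, converges t (strcode (node X m)) m = true -> violated t (strcode (node X m)) m = false.

Lemma length_node X m : length (node X m) = 2 * m.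
Proof. apply length_prefix. Qed.

Lemma active_node X m e : e < m -> active (strcode (node X m)) e = X (2 * e + 1).
Proof. intros L; unfold active, node; rewrite bit_strcode; apply nth_prefix; lia. Qed.

Lemma converges_eventually X m : admissible X ->
  eventually (fun t => converges t (strcode (node X m)) m = true).
Proof.
  intros [_ HX].
  apply (eventually_mono (fun t => forall e, e < m -> X (2 * e + 1) = true ->
    halted t e (strcode (node X m)) m = true /\
    forall c, In c [2; 4; 6] -> halted t e (extend (strcode (node X m)) m c) m = true)).
  { intros t H; apply converges_spec; intros e L; rewrite active_node by auto; auto. }
  apply eventually_below; intros e L.
  destruct (X (2 * e + 1)) eqn:E; [|exists 0; intros; discriminate].
  pose proof (HX e E) as H; set (p := strcode (node X m)).
  apply (eventually_mono (fun t => halted t e p m = true /\ halted t e (extend p m 2) m = true /\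
    halted t e (extend p m 4) m = true /\ halted t e (extend p m 6) m = true)).
  { intros t (H0 & H2 & H4 & H6) _; split; auto; intros c [<-|[<-|[<-|[]]]]; auto. }
  repeat apply eventually_and; auto.
Qed.

Lemma bit_strcode_prefix X n i : i < n -> bit (strcode (prefix X n)) i = X i.
Proof. intros; rewrite bit_strcode; apply nth_prefix; auto. Qed.

Lemma prefix_bit_prefix X n k : k <= n -> prefix (bit (strcode (prefix X n))) k = prefix X k.
Proof. intros; apply prefix_ext; intros; apply bit_strcode_prefix; lia. Qed.

Lemma prefix_code_node X m i : i <= m -> prefix_code (strcode (node X m)) (2 * i) = strcode (node X i).
Proof. intros; rewrite <- strcode_prefix; unfold node; rewrite prefix_bit_prefix; auto; lia. Qed.

Lemma prefix_bit_app l w : prefix (bit (strcode (l ++ w))) (length l) = l.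
Proof.
  transitivity (prefix (fun i => nth i l false) (length l)); [|apply prefix_nth].
  apply prefix_ext; intros i L; rewrite bit_strcode, app_nth1; auto.
Qed.

Definition index (t m y : nat) : nat := npair y (npair m t).

Lemma atom_index t y m : atom (index t m y) = atom_at t y m.
Proof. unfold atom, index; rewrite !pi2_pair, !pi1_pair; auto. Qed.

Lemma live_node X m : admissible X -> (forall i, i < m -> unviolated X i) ->
  eventually (fun t => converges t (strcode (node X m)) m = true /\
    live t (strcode (node X m)) m = true).
Proof.
  intros HX Hu.
  assert (H : eventually (fun t => forall i, i < S m -> converges t (strcode (node X i)) i = true)).
  { apply eventually_below; intros; apply converges_eventually; auto. }
  revert H; apply eventually_mono; intros t H; split; [apply H; lia|].
  unfold live; rewrite prefix_code_node, H by lia; rewrite andb_true_l; apply all_below_spec; intros i L.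
  rewrite prefix_code_node, H by lia; unfold node at 1; rewrite bit_strcode_prefix by lia.
  rewrite (proj1 HX), (Hu i L) by (apply H; lia); auto.
Qed.

(** Once the programs guessed to be total have halted, the node is live and receives an atom of its
    own, whose target extends the node. *)
Lemma meets_node X m : admissible X -> (forall i, i < m -> unviolated X i) ->
  exists j, meets (strcode (node X m)) j = true.
Proof.
  intros HX Hu; destruct (live_node X m HX Hu) as [t Ht]; destruct (Ht t (le_n t)) as [_ H].
  exists (index t m (strcode (node X m))); apply meets_spec; rewrite atom_index; unfold atom_at.
  rewrite H, prefix_code_node by lia.
  destruct (target_extends t (node X m) m (length_node X m)) as [w ->].
  symmetry; apply prefix_bit_app.
Qed.

(** The level [m'] of an atom through the node is compared with [m]. A lower level is impossible, at
    level [m] the atom is the target of the node, and at a higher level liveness has checked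
    convergence and the lack of violation at the node. In particular [m <= m' <= j]. *)
Lemma meets_node_inv X m j : admissible X -> (forall i, i < m -> unviolated X i) -> 0 < m ->
  meets (strcode (node X m)) j = true ->
  exists t, converges t (strcode (node X m)) m = true /\ m <= j /\
    (atom j = target t (strcode (node X m)) m \/ violated t (strcode (node X m)) m = false).
Proof.
  intros HX Hu Hm Hj; apply meets_spec in Hj; rewrite length_node in Hj; unfold node in Hj.
  pose proof (prefix_eq _ _ _ Hj) as Hbit; clear Hj; revert Hbit.
  unfold atom, atom_at.
  set (t := pi2 (pi2 j)); set (y := pi1 j); set (m' := pi1 (pi2 j)).
  assert (Lm : m' <= j) by (etransitivity; [apply pi1_le|apply pi2_le]).
  destruct (live t y m') eqn:Hl; intros Hbit.
  (* The default atom starts with 0, the path with 1; [0 < m] puts this bit inside the node. *)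
  2:{ specialize (Hbit (2 * 0) ltac:(lia)); rewrite (proj1 HX), bit_0 in Hbit; discriminate. }
  unfold live in Hl; rewrite andb_true_iff, all_below_spec in Hl; destruct Hl as [Hc Hl].
  rewrite <- !strcode_prefix in *.
  assert (Hy : forall i, i < 2 * m -> i < 2 * m' -> bit y i = X i).
  { intros i L L'; rewrite (Hbit i L).
    destruct (target_extends t (prefix (bit y) (2 * m')) m') as [w E]; [apply length_prefix|].
    rewrite E, bit_strcode, app_nth1 by (rewrite length_prefix; auto).
    rewrite nth_prefix; auto. }
  exists t; destruct (Nat.lt_trichotomy m' m) as [L|[L|L]].
  (* The lower node is not violated, so the atom continues it by zeros, while the path has a 1 at
     place [2 * m']. *)
  - exfalso.
    assert (E : prefix (bit y) (2 * m') = node X m') by (apply prefix_ext; intros; apply Hy; lia).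
    rewrite E in *; rewrite (target_not_violated t) in Hbit by (apply Hu; auto).
    specialize (Hbit (2 * m') ltac:(lia)).
    rewrite (proj1 HX), bit_strcode, nth_overflow in Hbit; [discriminate|].
    rewrite length_node; lia.
  - subst m'; rewrite L in *.
    assert (E : prefix (bit y) (2 * m) = node X m) by (apply prefix_ext; intros; apply Hy; lia).
    rewrite E in *; auto.
  - specialize (Hl m L); rewrite !andb_true_iff, negb_true_iff, <- strcode_prefix in Hl.
    assert (E : prefix (bit y) (2 * m) = node X m) by (apply prefix_ext; intros; apply Hy; lia).
    rewrite E in *; destruct Hl as [[_ H1] H2]; repeat split; auto; lia.
Qed.

(** The target does not depend on the stage, so by [meets_node_inv] every atom through a violated
    node is this same target. *)
Lemma meets_violation X m t : admissible X -> (forall i, i < m -> unviolated X i) ->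
  converges t (strcode (node X m)) m = true -> violated t (strcode (node X m)) m = true ->
  exists w, violates t (strcode (node X m)) m (strcode w) = true /\
    In (strcode w) [2; 4; 6] /\
    forall j, meets (strcode (node X m)) j = true -> meets (strcode (node X m ++ w)) j = true.
Proof.
  intros HX Hu Hc Hv; destruct (target_violated _ _ _ Hv) as (c & Hin & Ht & Hvc).
  destruct (code_cases c Hin) as (w & -> & _).
  exists w; repeat split; auto; intros j Hj.
  (* At level 0 no program is watched, hence nothing is violated. *)
  assert (Hm : 0 < m) by (destruct m; [discriminate|lia]).
  destruct (meets_node_inv X m j HX Hu Hm Hj) as (t' & Hc' & _ & H).
  destruct (target_stable t t' _ m Hc Hc') as [E1 E2].
  destruct H as [H|H]; [|congruence].
  apply meets_spec; rewrite H, <- E1, Ht, extend_strcode by apply length_node.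
  symmetry; rewrite <- (app_nil_r (node X m ++ w)) at 1; apply prefix_bit_app.
Qed.

Local Close Scope nat_scope.

(** * The measures *)

Definition term (r : R) (l : list bool) (j : nat) : R :=
  (1 - r) * r ^ j * (if meets (strcode l) j then 1 else 0).

Definition mass (r : R) (l : list bool) : R := Series (term r l).

Lemma is_series_weights r : 0 < r < 1 -> is_series (fun j => (1 - r) * r ^ j) 1.
Proof.
  intros Hr; assert (H : Rabs r < 1) by (rewrite Rabs_pos_eq; lra).
  apply is_series_geom, (is_series_scal (V := R_NormedModule) (1 - r)) in H.
  change (is_series (fun j => (1 - r) * r ^ j) ((1 - r) * / (1 - r))) in H.
  rewrite Rinv_r in H by lra; exact H.
Qed.

Lemma term_bounds r l j : 0 < r < 1 -> 0 <= term r l j <= (1 - r) * r ^ j.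
Proof.
  intros Hr; unfold term.
  assert (0 <= (1 - r) * r ^ j) by (apply Rmult_le_pos; [lra|apply pow_le; lra]).
  destruct (meets _ j); lra.
Qed.

Lemma ex_series_term r l : 0 < r < 1 -> ex_series (term r l).
Proof.
  intros Hr; apply (ex_series_le (V := R_CompleteNormedModule) _ (fun j => (1 - r) * r ^ j)).
  - intros j; pose proof (term_bounds r l j Hr); change (Rabs (term r l j) <= (1 - r) * r ^ j).
    rewrite Rabs_pos_eq; lra.
  - exists 1; apply is_series_weights; auto.
Qed.

(** Each atom through [l] passes through exactly one of its two extensions. *)
Lemma mass_split r l : 0 < r < 1 -> mass r l = mass r (l ++ [false]) + mass r (l ++ [true]).
Proof.
  intros Hr; unfold mass; rewrite <- Series_plus by (apply ex_series_term; auto).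
  apply Series_ext; intros j; unfold term.
  assert (E : forall b, meets (strcode (l ++ [b])) j =
    (meets (strcode l) j && Bool.eqb b (bit (atom j) (length l)))%bool).
  { intros b; apply eq_true_iff_eq.
    rewrite andb_true_iff, !meets_spec, eqb_true_iff, length_app, Nat.add_comm.
    simpl length; simpl Nat.add; rewrite prefix_S; split.
    - apply app_inj_tail.
    - intros [E ->]; rewrite <- E; auto. }
  rewrite !E; destruct (meets _ j), (bit _ _); simpl; ring.
Qed.

Lemma mass_nil r : 0 < r < 1 -> mass r [] = 1.
Proof.
  intros Hr; rewrite <- (is_series_unique _ _ (is_series_weights r Hr)).
  apply Series_ext; intros j; unfold term.
  rewrite (proj2 (meets_spec [] j)) by reflexivity; ring.
Qed.

Lemma tail_bounds r l n : 0 < r < 1 -> 0 <= Series (fun k => term r l (n + k)) <= r ^ n.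
Proof.
  intros Hr; split.
  - rewrite <- (Rmult_0_l (Series (fun _ => 0))), <- Series_scal_l.
    apply Series_le; [|apply (ex_series_incr_n (term r l)), ex_series_term; auto].
    intros k; pose proof (term_bounds r l (n + k) Hr); lra.
  - rewrite <- (Rmult_1_r (r ^ n)), <- (is_series_unique _ _ (is_series_weights r Hr)).
    rewrite <- Series_scal_l; apply Series_le.
    + intros k; pose proof (term_bounds r l (n + k) Hr); rewrite pow_add in *; lra.
    + apply (ex_series_scal_l (V := R_NormedModule)); exists 1; apply is_series_weights; auto.
Qed.

Lemma mass_nonneg r l : 0 < r < 1 -> 0 <= mass r l.
Proof. intros Hr; apply (tail_bounds r l 0 Hr). Qed.

Lemma mass_le_1 r l : 0 < r < 1 -> mass r l <= 1.
Proof. intros Hr; apply (tail_bounds r l 0 Hr). Qed.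

Lemma mass_ext r l l' : (forall j, meets (strcode l) j = meets (strcode l') j) ->
  mass r l = mass r l'.
Proof. intros H; apply Series_ext; intros j; unfold term; rewrite H; auto. Qed.

Lemma mass_0 r l : (forall j, meets (strcode l) j = false) -> mass r l = 0.
Proof.
  intros H; unfold mass; rewrite <- (Rmult_0_l (Series (fun _ => 0))), <- Series_scal_l.
  apply Series_ext; intros j; unfold term; rewrite H; ring.
Qed.

(** For r = 1/b, the sum of the first n terms has denominator b^n; this is its numerator, by
    Horner's rule. *)
Definition count (b n s : nat) : nat :=
  nat_rect (fun _ => nat) 0%nat (fun j c => b * c + (b - 1) * Nat.b2n (meets s j))%nat n.

Lemma computable_count k b n s : computable k n -> computable k s ->
  computable k (fun v => count b (n v) (s v)).
Proof.
  intros; apply (computable_rec k _ (fun _ => 0%nat)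
    (fun j c v => b * c + (b - 1) * Nat.b2n (meets (s v) j))%nat); comp.
Qed.
#[local] Hint Resolve computable_count : comp.

Definition estimate (b n : nat) (l : list bool) : R :=
  INR (count b n (strcode l)) / INR b ^ n.

Lemma inv_INR_bounds b : (2 <= b)%nat -> 0 < / INR b < 1.
Proof.
  intros Hb; apply le_INR in Hb; simpl in Hb; split; [apply Rinv_0_lt_compat; lra|].
  rewrite <- Rinv_1; apply Rinv_lt_contravar; lra.
Qed.

Lemma count_S b n s : count b (S n) s = (b * count b n s + (b - 1) * Nat.b2n (meets s n))%nat.
Proof. reflexivity. Qed.

Lemma mass_estimate b n l : (2 <= b)%nat ->
  mass (/ INR b) l = estimate b n l + Series (fun k => term (/ INR b) l (n + k)).
Proof.
  intros Hb; pose proof (inv_INR_bounds b Hb) as Hr.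
  assert (Hb' := le_INR _ _ Hb); simpl in Hb'.
  induction n as [|n IH].
  - unfold estimate; simpl; unfold Rdiv; rewrite Rmult_0_l, Rplus_0_l; auto.
  - rewrite IH, Series_incr_1 by (apply (ex_series_incr_n (term (/ INR b) l)), ex_series_term; auto).
    rewrite <- Rplus_assoc; f_equal.
    + rewrite Nat.add_0_r; unfold estimate, term; rewrite count_S.
      rewrite plus_INR, !mult_INR, minus_INR by lia.
      rewrite pow_inv; simpl INR; simpl pow.
      assert (INR b ^ n <> 0) by (apply pow_nonzero; lra).
      destruct (meets _ n); simpl; field; repeat split; auto; lra.
    + apply Series_ext; intros k; f_equal; lia.
Qed.

Lemma mass_estimate_bounds b n l : (2 <= b)%nat ->
  estimate b n l <= mass (/ INR b) l <= estimate b n l + (/ INR b) ^ n.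
Proof.
  intros Hb; rewrite (mass_estimate b n l Hb);
  pose proof (tail_bounds _ l n (inv_INR_bounds b Hb)); lra.
Qed.

Lemma estimate_nonneg b n l : (2 <= b)%nat -> 0 <= estimate b n l.
Proof.
  intros Hb; apply le_INR in Hb; simpl in Hb; apply Rmult_le_pos; [apply pos_INR|].
  apply Rlt_le, Rinv_0_lt_compat, pow_lt; lra.
Qed.

(** The atom [j] alone contributes (b - 1) / b^(j+1). This keeps the denominators in
    [ratio_estimate] away from 0. *)
Lemma estimate_lower b n l j : (2 <= b)%nat -> meets (strcode l) j = true -> (j < n)%nat ->
  (/ INR b) ^ (S j) <= estimate b n l.
Proof.
  intros Hb Hj L; assert (Hb' := le_INR _ _ Hb); simpl in Hb'.
  assert (G : (b ^ n <= b ^ S j * count b n (strcode l))%nat).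
  { induction L as [|n L IH].
    - rewrite count_S, Hj; simpl Nat.b2n; rewrite <- (Nat.mul_1_r (b ^ S j)) at 1.
      apply Nat.mul_le_mono_l; nia.
    - rewrite count_S, (Nat.pow_succ_r' b n), Nat.mul_add_distr_l.
      etransitivity; [apply Nat.mul_le_mono_l, IH|].
      rewrite Nat.mul_shuffle3; apply Nat.le_add_r. }
  apply le_INR in G; rewrite mult_INR, !pow_INR in G.
  assert (0 < INR b ^ n) by (apply pow_lt; lra).
  assert (0 < INR b ^ S j) by (apply pow_lt; lra).
  unfold estimate; rewrite pow_inv.
  apply (Rmult_le_reg_r (INR b ^ n)); auto; apply (Rmult_le_reg_l (INR b ^ S j)); auto.
  field_simplify; lra.
Qed.

Lemma mass_pos b l j : (2 <= b)%nat -> meets (strcode l) j = true -> 0 < mass (/ INR b) l.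
Proof.
  intros Hb Hj; pose proof (estimate_lower b (S j) l j Hb Hj (Nat.lt_succ_diag_r j)) as H.
  pose proof (mass_estimate_bounds b (S j) l Hb); apply le_INR in Hb; simpl in Hb.
  assert (0 < (/ INR b) ^ S j) by (apply pow_lt, Rinv_0_lt_compat; lra); lra.
Qed.

Lemma mass_pos_inv r l : 0 < mass r l -> exists j, meets (strcode l) j = true.
Proof.
  intros H; destruct (Classical_Prop.classic (exists j, meets (strcode l) j = true)) as [|N]; auto.
  rewrite mass_0 in H; [lra|]; intros j; apply not_true_is_false; intros E; apply N; eauto.
Qed.

(** * The measure [mu] and the partial computable martingale [nu / mu] *)

Definition mu : list bool -> R := mass (/ INR 4).
Definition nu : list bool -> R := mass (/ INR 2).

Lemma quarter_bounds : 0 < / INR 4 < 1.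
Proof. simpl; lra. Qed.
Lemma half_bounds : 0 < / INR 2 < 1.
Proof. simpl; lra. Qed.

Lemma prob_measure_mu : prob_measure mu.
Proof.
  repeat split; intros; [apply mass_nil|apply mass_nonneg|apply mass_split]; apply quarter_bounds.
Qed.

Lemma rat_of_code_pair a b : rat_of_code (npair (2 * a) b) = INR a / INR (S b).
Proof.
  unfold rat_of_code; rewrite unpair_pair; unfold int_of_code.
  rewrite Nat.even_mul, Nat.mul_comm, Nat.div_mul by lia; auto.
Qed.

Lemma computable_measure_mu : computable_measure mu.
Proof.
  destruct (computable_ext 2 (fun v => npair (2 * count 4 (nth 1 v 0%nat) (nth 0 v 0%nat))
    (pred (4 ^ nth 1 v 0%nat))) _ (fun v _ => eq_refl) ltac:(comp)) as [c Hc].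
  exists c; intros l n; eexists; split; [apply (Hc [strcode l; n]); reflexivity|].
  simpl nth; rewrite rat_of_code_pair, Nat.succ_pred by (apply Nat.pow_nonzero; lia).
  rewrite pow_INR; fold (estimate 4 n l).
  pose proof (mass_estimate_bounds 4 n l ltac:(lia)).
  assert ((/ INR 4) ^ n <= (/ 2) ^ n) by (apply pow_incr; simpl; lra).
  unfold mu; rewrite Rabs_minus_sym, Rabs_pos_eq; lra.
Qed.

Definition ratio (l : list bool) : option R :=
  if Rlt_dec 0 (mu l) then Some (nu l / mu l) else None.

(** Both measures charge the same atoms, so [nu] vanishes wherever [mu] does. The martingale
    equation for [ratio] thereby becomes the additivity of [nu]. *)
Lemma mterm_ratio l : mterm mu ratio l = nu l.
Proof.
  unfold mterm, ratio; destruct (Rlt_dec 0 (mu l)); [field; lra|].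
  symmetry; apply mass_0; intros j; apply not_true_is_false; intros E.
  apply n, (mass_pos 4 l j); auto; lia.
Qed.

Lemma martingale_ratio : martingale mu ratio.
Proof.
  repeat split.
  - intros l H; unfold ratio; destruct (Rlt_dec 0 (mu l)); [discriminate|contradiction].
  - unfold ratio; intros l x; destruct (Rlt_dec 0 (mu l)) as [H|]; [|discriminate].
    intros [= <-]; apply Rmult_le_pos; [apply mass_nonneg, half_bounds|].
    apply Rlt_le, Rinv_0_lt_compat; auto.
  - intros l; rewrite !mterm_ratio; symmetry; apply mass_split, half_bounds.
Qed.

(** Put d = 2^-(j+1) and e = 2^-n. Both Q and [mu l] are at least d^2, and |P mu - nu Q| is at most
    2e, because P and Q approximate [nu l] and [mu l] within e and e^2. The precision n is chosen to
    give 2e = d^4 2^-k. *)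
Lemma ratio_estimate l j k : meets (strcode l) j = true ->
  let n := (4 * j + 5 + k)%nat in
  Rabs (estimate 2 n l / estimate 4 n l - nu l / mu l) <= (/ 2) ^ k.
Proof.
  intros Hj n.
  pose proof (mass_estimate_bounds 2 n l ltac:(lia)) as HP.
  pose proof (mass_estimate_bounds 4 n l ltac:(lia)) as HQ.
  pose proof (estimate_nonneg 2 n l ltac:(lia)) as HP0.
  pose proof (estimate_lower 4 n l j ltac:(lia) Hj ltac:(lia)) as HQ0.
  pose proof (mass_le_1 _ l half_bounds) as HP1.
  pose proof (mass_le_1 _ l quarter_bounds) as HQ1.
  fold (nu l) in HP, HP1; fold (mu l) in HQ, HQ1.
  set (P := estimate 2 n l) in *; set (Q := estimate 4 n l) in *.
  assert (E4 : forall i, (/ INR 4) ^ i = (/ 2) ^ i * (/ 2) ^ i).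
  { intros i; rewrite <- Rpow_mult_distr; f_equal; simpl; field. }
  rewrite E4 in HQ0, HQ; replace (/ INR 2) with (/ 2) in HP by (simpl; lra).
  set (d := (/ 2) ^ S j) in *; set (e := (/ 2) ^ n) in *.
  assert (Hd : 0 < d) by (apply pow_lt; lra).
  assert (He : 0 < e) by (apply pow_lt; lra).
  assert (He1 : e <= 1) by (unfold e; rewrite <- (pow1 n); apply pow_incr; lra).
  assert (Hdd : 0 < d * d) by (apply Rmult_lt_0_compat; auto).
  assert (Ee : 2 * e = d * d * (d * d) * (/ 2) ^ k).
  { unfold e, d, n; replace (4 * j + 5 + k)%nat with (S (S j + S j + (S j + S j) + k)) by lia.
    change ((/ 2) ^ S (S j + S j + (S j + S j) + k)) with (/ 2 * (/ 2) ^ (S j + S j + (S j + S j) + k)).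
    rewrite !pow_add; field. }
  assert (Hmu : 0 < mu l) by lra.
  replace (P / Q - nu l / mu l) with ((P * mu l - nu l * Q) / (Q * mu l)) by (field; lra).
  assert (HQm : d * d * (d * d) <= Q * mu l) by (apply Rmult_le_compat; lra).
  unfold Rdiv; rewrite Rabs_mult, Rabs_inv, (Rabs_pos_eq (Q * mu l)) by nra.
  apply (Rmult_le_reg_r (Q * mu l)); [nra|]; rewrite Rmult_assoc, Rinv_l, Rmult_1_r by nra.
  apply (Rle_trans _ (2 * e)).
  - apply Rabs_le; split; nra.
  - rewrite Ee; assert (0 < (/ 2) ^ k) by (apply pow_lt; lra); nra.
Qed.

(** The program searches for the first atom through [l], which exists exactly when [mu l > 0], so it
    diverges just where [ratio] is undefined. The index found bounds [mu l] from below and so fixes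
    the precision to use. *)
Lemma computable_martingale_ratio : computable_martingale ratio.
Proof.
  destruct (computable_ext 3 (fun v => Nat.b2n (negb (meets (nth 1 v 0%nat) (nth 0 v 0%nat))))
    _ (fun v _ => eq_refl) ltac:(comp)) as [cf Hf].
  set (len := fun v => (4 * nth 0 v 0 + 5 + nth 2 v 0)%nat).
  (* The quotient of the two estimates is count2 * 2^n / count4, as 4^n / 2^n = 2^n. Doubling codes
     a nonnegative integer, and [pred] offsets the successor in the denominator of [rat_of_code]. *)
  destruct (computable_ext 3 (fun v =>
    npair (2 * (count 2 (len v) (nth 1 v 0%nat) * 2 ^ len v))
         (pred (count 4 (len v) (nth 1 v 0%nat))))
    _ (fun v _ => eq_refl) ltac:(unfold len; comp)) as [ch Hh].
  exists (CComp ch [CMu cf; CProj 0; CProj 1]); intros l.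
  assert (HF : forall n i, halts_with cf [i; strcode l; n] (Nat.b2n (negb (meets (strcode l) i))))
    by (intros n i; apply (Hf [i; strcode l; n]); auto).
  split.
  - intros x; unfold ratio; destruct (Rlt_dec 0 (mu l)) as [Hm|]; [|discriminate].
    intros [= <-] k; apply mass_pos_inv in Hm as Hex.
    assert (Hmin : exists j, meets (strcode l) j = true /\
      forall i, (i < j)%nat -> meets (strcode l) i = false).
    { destruct (dec_inh_nat_subset_has_unique_least_element
        (fun j => meets (strcode l) j = true)) as (j & [Hj Hl] & _); auto.
      - intros j; destruct (meets (strcode l) j); auto.
      - exists j; split; auto; intros i Li; apply not_true_is_false; intros E.
        apply Hl in E; lia. }
    destruct Hmin as (j & Hj & Hl); eexists; split.
    + apply (halts_CComp _ _ _ [j; strcode l; k]).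
      * repeat constructor; try (exists 1%nat; reflexivity).
        apply (halts_CMu cf _ _ j (HF k)); [rewrite Hj; auto|].
        intros i Li; rewrite Hl; auto.
      * apply Hh; auto.
    + unfold len; simpl nth; rewrite rat_of_code_pair.
      set (n := (4 * j + 5 + k)%nat).
      pose proof (estimate_lower 4 n l j ltac:(lia) Hj ltac:(lia)) as HQ.
      assert (H4 : 0 < (/ INR 4) ^ S j) by (apply pow_lt; simpl; lra).
      assert (Hc : count 4 n (strcode l) <> 0%nat).
      { intros E; unfold estimate in HQ; rewrite E in HQ; unfold Rdiv in HQ; simpl INR in HQ at 3.
        rewrite Rmult_0_l in HQ; lra. }
      rewrite Nat.succ_pred by auto.
      replace (INR _ / INR _) with (estimate 2 n l / estimate 4 n l).
      { apply (ratio_estimate l j k Hj). }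
      unfold estimate; rewrite mult_INR, pow_INR; apply not_0_INR in Hc.
      replace (INR 4) with (INR 2 * INR 2) by (simpl; lra); rewrite Rpow_mult_distr.
      assert (INR 2 ^ n <> 0) by (apply pow_nonzero; simpl; lra).
      field; auto.
  - unfold ratio; destruct (Rlt_dec 0 (mu l)) as [|N]; [discriminate|]; intros _ n.
    apply CComp_diverges, (CMu_diverges cf _ _ (HF n)); intros i.
    destruct (meets (strcode l) i) eqn:E; [|simpl; lia].
    exfalso; apply N, (mass_pos 4 l i); auto; lia.
Qed.

(** * Total martingales along the path *)

Definition computes_values (c : code) (M : list bool -> option R) : Prop :=
  forall s x, M s = Some x -> computes_Cauchy_name c [strcode s] x.

Lemma computes_values_halted c M : total M -> computes_values c M ->
  forall l n, eventually (fun t => halted t (goedel c) (strcode l) n = true).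
Proof.
  intros HT HM l n; destruct (M l) as [x|] eqn:E; [|destruct (HT l E)].
  destruct (HM l x E n) as (o & Ho & _).
  destruct (universal_complete _ _ _ _ Ho) as [t0 H]; exists t0; intros t L.
  apply halted_S; eauto.
Qed.

Definition quotient (o : nat) : R := INR (numerator o) / INR (denominator o).

Transparent pi1 pi2.

(** Truncating a negative rational to 0 brings it closer to the nonnegative [x]. *)
Lemma quotient_approx o x e : 0 <= x -> Rabs (rat_of_code o - x) <= e -> Rabs (quotient o - x) <= e.
Proof.
  intros Hx; unfold quotient, numerator, denominator, rat_of_code, int_of_code, pi1, pi2.
  destruct (unpair o) as [a b]; simpl fst; simpl snd; destruct (Nat.even a); auto.
  assert (0 < INR (S b)) by (apply lt_0_INR; lia).
  assert (0 <= INR ((a + 1) / 2) / INR (S b)).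
  { apply Rmult_le_pos; [apply pos_INR|apply Rlt_le, Rinv_0_lt_compat; auto]. }
  simpl (INR 0); unfold Rdiv in *; rewrite Rmult_0_l, <- Ropp_mult_distr_l.
  rewrite !Rabs_left1; lra.
Qed.

(** The program halts with a correct approximation, which the machine eventually returns; since
    returned values persist, [o] is that approximation. *)
Lemma universal_approx c M t l n o x : computes_values c M -> M l = Some x -> 0 <= x ->
  universal t (goedel c) (strcode l) n = S o -> Rabs (quotient o - x) <= (/ 2) ^ n.
Proof.
  intros HM E Hx Ho; destruct (HM l x E n) as (o' & Ho' & H).
  destruct (universal_complete _ _ _ _ Ho') as [t0 Ht0].
  specialize (Ht0 (t + t0)%nat ltac:(lia)).
  apply (universal_le t (t + t0)) in Ho; [|lia].
  replace o with o' by congruence; apply quotient_approx; auto.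
Qed.

Lemma exceeds_quotient m o o' :
  exceeds m o o' = true <-> quotient o' + 2 * (/ 2) ^ m < quotient o.
Proof.
  unfold exceeds, quotient; rewrite Nat.ltb_lt.
  set (a := numerator o); set (a' := numerator o').
  assert (Hd : 0 < INR (denominator o)) by (apply lt_0_INR; unfold denominator; lia).
  assert (Hd' : 0 < INR (denominator o')) by (apply lt_0_INR; unfold denominator; lia).
  set (d := denominator o) in *; set (d' := denominator o') in *; clearbody d d'.
  assert (H2 : 0 < 2 ^ m) by (apply pow_lt; lra).
  assert (HP : 0 < INR d * INR d' * 2 ^ m) by (repeat apply Rmult_lt_0_compat; auto).
  assert (E : ((a' * 2 ^ m + 2 * d') * d < a * d' * 2 ^ m)%nat <->
    (INR a' / INR d' + 2 * (/ 2) ^ m) * (INR d * INR d' * 2 ^ m) <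
    INR a / INR d * (INR d * INR d' * 2 ^ m)).
  { replace ((INR a' / INR d' + 2 * (/ 2) ^ m) * (INR d * INR d' * 2 ^ m))
      with (INR ((a' * 2 ^ m + 2 * d') * d)).
    2:{ rewrite !mult_INR, plus_INR, !mult_INR, pow_INR, pow_inv; simpl INR.
        replace (1 + 1) with 2 by ring; field; lra. }
    replace (INR a / INR d * (INR d * INR d' * 2 ^ m)) with (INR (a * d' * 2 ^ m)).
    2:{ rewrite !mult_INR, pow_INR; replace (INR 2) with 2 by (simpl; ring); field; lra. }
    split; [apply lt_INR|apply INR_lt]. }
  rewrite E; split; intros H; [apply Rmult_lt_reg_r in H|apply Rmult_lt_compat_r]; auto.
Qed.

Lemma mass_app r l w : 0 < r < 1 -> mass r (l ++ w) <= mass r l.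
Proof.
  intros Hr; induction w as [|b w IH] using rev_ind; [rewrite app_nil_r; lra|].
  rewrite app_assoc; pose proof (mass_split r (l ++ w) Hr).
  pose proof (mass_nonneg r ((l ++ w) ++ [false]) Hr).
  pose proof (mass_nonneg r ((l ++ w) ++ [true]) Hr).
  destruct b; lra.
Qed.

(** Along [w] the siblings have measure 0, so each step of the martingale equation reads M(parent)
    [mu l] = M(child) [mu l]. *)
Lemma martingale_const M l w x y : martingale mu M -> 0 < mu l -> mu (l ++ w) = mu l ->
  M l = Some x -> M (l ++ w) = Some y -> y = x.
Proof.
  intros (HD & _ & HF) Hl Hw Ex; revert y Hw; induction w as [|b w IH] using rev_ind; intros y Hw Ey.
  - rewrite app_nil_r in Ey; congruence.
  - rewrite app_assoc in Hw, Ey.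
    pose proof (mass_app _ l w quarter_bounds) as H1; fold (mu l) (mu (l ++ w)) in H1.
    pose proof (mass_app _ (l ++ w) [b] quarter_bounds) as H2.
    fold (mu (l ++ w)) (mu ((l ++ w) ++ [b])) in H2.
    assert (E : mu (l ++ w) = mu l) by lra.
    destruct (M (l ++ w)) as [z|] eqn:Ez; [|destruct (HD (l ++ w)); auto; lra].
    rewrite <- (IH z E eq_refl); clear IH.
    pose proof (mass_split _ (l ++ w) quarter_bounds) as Hs.
    fold (mu (l ++ w)) (mu ((l ++ w) ++ [false])) (mu ((l ++ w) ++ [true])) in Hs.
    specialize (HF (l ++ w)); unfold mterm in HF; rewrite Ez in HF.
    destruct b; rewrite Ey in HF.
    + rewrite (ltac:(lra) : mu ((l ++ w) ++ [false]) = 0) in HF.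
      rewrite Hw, E in HF; destruct (M _); apply (Rmult_eq_reg_r (mu l)); lra.
    + rewrite (ltac:(lra) : mu ((l ++ w) ++ [true]) = 0) in HF.
      rewrite Hw, E in HF; destruct (M ((l ++ w) ++ [true])); apply (Rmult_eq_reg_r (mu l)); lra.
Qed.

Definition good (e : nat) : Prop := exists c M,
  e = goedel c /\ martingale mu M /\ total M /\ computes_values c M.

Definition path (n : nat) : bool :=
  if Nat.even n then true
  else if excluded_middle_informative (good (Nat.div2 n)) then true else false.

Lemma path_even m : path (2 * m) = true.
Proof. unfold path; rewrite Nat.even_mul; auto. Qed.

Lemma path_odd e : path (2 * e + 1) = true <-> good e.
Proof.
  unfold path; rewrite Nat.even_add, Nat.even_mul, Nat.add_1_r, Nat.div2_succ_double; simpl.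
  destruct (excluded_middle_informative (good e)); split; auto; discriminate.
Qed.

Lemma strcode_surj x : exists l, strcode l = x.
Proof.
  induction x as [x IH] using lt_wf_ind; destruct x as [|x]; [exists []; auto|].
  pose proof (Nat.div_mod_eq x 2) as E; pose proof (Nat.mod_upper_bound x 2).
  destruct (IH (x / 2)%nat) as [l Hl]; [nia|].
  exists ((x mod 2 =? 1)%nat :: l); rewrite strcode_cons, Hl.
  destruct (Nat.eqb_spec (x mod 2) 1); simpl Nat.b2n; lia.
Qed.

Lemma admissible_path : admissible path.
Proof.
  split; [apply path_even|]; intros e (c & M & -> & _ & HT & HM)%path_odd x n.
  destruct (strcode_surj x) as [l <-]; apply (computes_values_halted c M); auto.
Qed.

Lemma mu_node_pos m : (forall i, (i < m)%nat -> unviolated path i) -> 0 < mu (node path m).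
Proof.
  intros H; destruct (meets_node path m admissible_path H) as [j Hj].
  apply (mass_pos 4 _ j); auto; lia.
Qed.

(** A violation would move the whole mass of the node to an extension, where the offending program,
    correctly guessed to compute a total martingale, must have the same value as at the node; but it
    has announced a clearly larger one. *)
Lemma unviolated_path m : unviolated path m.
Proof.
  induction m as [m IH] using lt_wf_ind; intros t Hc; apply not_true_is_false; intros Hv.
  destruct (meets_violation path m t admissible_path IH Hc Hv) as (w & Hw & Hin & Hall).
  pose proof (mu_node_pos m IH) as Hpos.
  assert (Emu : mu (node path m ++ w) = mu (node path m)).
  { apply mass_ext; intros j; apply eq_true_iff_eq; split; [|apply Hall].
    rewrite !meets_spec, length_app; intros E.
    pose proof (f_equal (firstn (length (node path m))) E) as E'.
    rewrite firstn_app, Nat.sub_diag, firstn_all, firstn_0, app_nil_r in E'.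
    etransitivity; [exact E'|]; rewrite prefix_add, firstn_app, length_prefix, Nat.sub_diag.
    rewrite firstn_0, app_nil_r; apply firstn_all2; rewrite length_prefix; lia. }
  apply some_below_spec in Hw as (e & L & He); apply andb_true_iff in He as [Ha He].
  pose proof (proj1 (converges_spec _ _ _) Hc e L Ha) as [[o Ho]%halted_S H1].
  specialize (H1 _ Hin); apply halted_S in H1 as [o' Ho']; rewrite Ho, Ho' in He.
  rewrite extend_strcode in Ho' by apply length_node.
  rewrite active_node in Ha by auto; apply path_odd in Ha as (c & M & -> & HMm & HT & HM).
  destruct (M (node path m)) as [x|] eqn:Ex; [|destruct (HT _ Ex)].
  destruct (M (node path m ++ w)) as [y|] eqn:Ey; [|destruct (HT _ Ey)].
  pose proof (martingale_const M _ _ _ _ HMm Hpos Emu Ex Ey); subst y.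
  pose proof (proj1 (proj2 HMm) _ _ Ex) as Hx.
  pose proof (universal_approx c M t _ _ _ x HM Ex Hx Ho) as A1.
  pose proof (universal_approx c M t _ _ _ x HM Ey Hx Ho') as A2.
  apply exceeds_quotient in He; simpl pred in He.
  (* Two approximations of [x] up to 2^-m cannot differ by more than 2 * 2^-m. *)
  apply Rabs_le_between in A1, A2; lra.
Qed.

(** Without violation the announced values grow by at most 2 * 2^-m, and each of the two is off by
    at most 2^-m. *)
Lemma martingale_increase c M m w x y : martingale mu M -> total M -> computes_values c M ->
  (goedel c < m)%nat -> In w [[true]; [true; false]; [true; true]] ->
  M (node path m) = Some x -> M (node path m ++ w) = Some y -> y <= x + 4 * (/ 2) ^ m.
Proof.
  intros HMm HT HM L Hw Ex Ey.
  destruct (converges_eventually path m admissible_path) as [t Ht].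
  specialize (Ht t (le_n t)).
  assert (Hin : In (strcode w) [2; 4; 6]%nat) by (destruct Hw as [<-|[<-|[<-|[]]]]; simpl; auto).
  pose proof (violated_false _ _ _ _ (unviolated_path m t Ht) Hin) as Hv.
  assert (Ha : active (strcode (node path m)) (goedel c) = true).
  { rewrite active_node by auto; apply path_odd; exists c, M; auto. }
  pose proof (proj1 (converges_spec _ _ _) Ht _ L Ha) as [[o Ho]%halted_S H1].
  specialize (H1 _ Hin); apply halted_S in H1 as [o' Ho'].
  assert (He : exceeds m o' o = false).
  { apply not_true_is_false; intros He; apply eq_true_false_abs in Hv; auto.
    apply some_below_spec; exists (goedel c); rewrite Ha, Ho, Ho'; auto. }
  rewrite extend_strcode in Ho' by apply length_node.
  destruct HMm as (_ & Hp & _).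
  pose proof (universal_approx c M t _ _ _ x HM Ex (Hp _ _ Ex) Ho) as A1.
  pose proof (universal_approx c M t _ _ _ y HM Ey (Hp _ _ Ey) Ho') as A2.
  apply Rabs_le_between in A1, A2.
  destruct (Rlt_dec (quotient o + 2 * (/ 2) ^ m) (quotient o')) as [K|]; [|lra].
  apply exceeds_quotient in K; congruence.
Qed.

Lemma bounded_below_length M (X : nat -> bool) n : exists B : R,
  forall k x, (k < n)%nat -> M (prefix X k) = Some x -> x <= B.
Proof.
  induction n as [|n [B HB]]; [exists 0; intros; lia|].
  exists (Rmax B (match M (prefix X n) with Some x => x | None => 0 end)).
  intros k x L E; destruct (Nat.eq_dec k n) as [->|].
  - rewrite E; apply Rmax_r.
  - etransitivity; [apply (HB k x); auto; lia|apply Rmax_l].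
Qed.

Lemma total_martingale_fails M : martingale mu M -> computable_martingale M -> total M ->
  ~ succeeds M path.
Proof.
  intros HMm [c Hc] HT [_ HS].
  assert (HM : computes_values c M) by (intros s x; apply Hc).
  (* From level [m0] on, the program of [M] is among those watched at the node. *)
  set (m0 := S (goedel c)).
  destruct (M (node path m0)) as [x0|] eqn:E0; [|destruct (HT _ E0)].
  (* The bound rises by exactly 4 * 2^-m from [m] to [m + 1]. *)
  assert (Hnode : forall m x, (m0 <= m)%nat -> M (node path m) = Some x ->
    x <= x0 + 8 * (1 - (/ 2) ^ m)).
  { assert (Hpow : forall i, (/ 2) ^ i <= 1).
    { intros i; rewrite <- (pow1 i); apply pow_incr; lra. }
    intros m x L; revert x; induction L as [|m L IH]; intros x Ex.
    - pose proof (Hpow m0); rewrite E0 in Ex; injection Ex as <-; lra.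
    - destruct (M (node path m)) as [y|] eqn:Ey; [|destruct (HT _ Ey)].
      specialize (IH y eq_refl).
      assert (En : node path (S m) = node path m ++ [true; path (2 * m + 1)]).
      { unfold node; replace (2 * S m)%nat with (S (S (2 * m))) by lia.
        rewrite !prefix_S, <- app_assoc, path_even, Nat.add_1_r; auto. }
      rewrite En in Ex.
      assert (x <= y + 4 * (/ 2) ^ m).
      { apply (martingale_increase c M m _ y x HMm HT HM L) in Ex; auto.
        destruct (path (2 * m + 1)); simpl; auto. }
      simpl pow; lra. }
  destruct (bounded_below_length M path (2 * m0)) as [B HB].
  (* 8 bounds the growth along the nodes, and 4 the step from a node to the prefix of odd length
     after it. *)
  destruct (HS (Rmax B (x0 + 12))) as (n & x & Ex & Hx).
  pose proof (Rmax_l B (x0 + 12)); pose proof (Rmax_r B (x0 + 12)).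
  destruct (Nat.lt_ge_cases n (2 * m0)) as [L|L].
  { specialize (HB n x L Ex); lra. }
  assert (Hpow : forall i, 0 < (/ 2) ^ i <= 1).
  { intros i; split; [apply pow_lt; lra|rewrite <- (pow1 i); apply pow_incr; lra]. }
  destruct (Nat.Even_or_Odd n) as [[m ->]|[m ->]].
  - specialize (Hnode m x ltac:(lia) Ex); pose proof (Hpow m); lra.
  - destruct (M (node path m)) as [y|] eqn:Ey; [|destruct (HT _ Ey)].
    specialize (Hnode m y ltac:(lia) Ey).
    rewrite Nat.add_1_r, prefix_S, path_even in Ex.
    assert (x <= y + 4 * (/ 2) ^ m).
    { apply (martingale_increase c M m [true] y x); simpl; auto; unfold m0 in L; lia. }
    pose proof (Hpow m); lra.
Qed.

Lemma mu_prefix_pos n : 0 < mu (prefix path n).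
Proof.
  pose proof (mu_node_pos n (fun i _ => unviolated_path i)) as H.
  apply (Rlt_le_trans _ _ _ H).
  unfold node; simpl Nat.mul; rewrite Nat.add_0_r, prefix_add; apply mass_app, quarter_bounds.
Qed.

(** Termwise: an atom through the node has index j >= m, and its weights in [nu] and [mu] have the
    quotient (2/3) 2^j, which exceeds 2^m / 2. *)
Lemma nu_node m : (0 < m)%nat -> 2 ^ m / 2 * mu (node path m) <= nu (node path m).
Proof.
  intros Hm; unfold mu, nu, mass; rewrite <- Series_scal_l.
  apply Series_le; [|apply ex_series_term, half_bounds].
  intros j; split.
  - apply Rmult_le_pos; [|apply term_bounds, quarter_bounds].
    apply Rlt_le, Rdiv_lt_0_compat; [apply pow_lt|]; lra.
  - unfold term; destruct (meets (strcode (node path m)) j) eqn:E; [|rewrite !Rmult_0_r; lra].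
    destruct (meets_node_inv path m j admissible_path (fun i _ => unviolated_path i) Hm E)
      as (_ & _ & L & _).
    replace ((/ INR 4) ^ j) with ((/ 2) ^ j * (/ 2) ^ j)
      by (rewrite <- Rpow_mult_distr; f_equal; simpl; field).
    replace (/ INR 2) with (/ 2) by (simpl; lra).
    assert (H : 2 ^ m * (/ 2) ^ j <= 1).
    { rewrite pow_inv; apply (Rle_pow 2) in L; [|lra].
      apply (Rmult_le_reg_r (2 ^ j)); [apply pow_lt; lra|].
      rewrite Rmult_assoc, Rinv_l; [lra|apply pow_nonzero; lra]. }
    assert (H0 : 0 < (/ 2) ^ j) by (apply pow_lt; lra).
    replace (1 - / INR 4) with (3 / 4) by (simpl; lra).
    set (z := (/ 2) ^ j) in *; set (q := 2 ^ m) in *; nra.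
Qed.

Lemma ratio_succeeds : succeeds ratio path.
Proof.
  assert (E : forall n, ratio (prefix path n) = Some (nu (prefix path n) / mu (prefix path n))).
  { intros n; unfold ratio; destruct (Rlt_dec 0 _) as [|N]; auto; destruct (N (mu_prefix_pos n)). }
  split; [intros n; rewrite E; discriminate|].
  intros B; destruct (Pow_x_infinity 2 ltac:(rewrite Rabs_pos_eq; lra) (2 * Rmax B 0 + 1)) as [m Hm].
  specialize (Hm (S m) ltac:(lia)); rewrite Rabs_pos_eq in Hm by (apply pow_le; lra).
  exists (2 * S m)%nat; eexists; split; [apply E|].
  pose proof (nu_node (S m) ltac:(lia)) as H.
  pose proof (mu_prefix_pos (2 * S m)) as H0; fold (node path (S m)) in *.
  pose proof (Rmax_l B 0).
  apply (Rlt_le_trans _ (2 ^ S m / 2)); [lra|].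
  apply (Rmult_le_reg_r (mu (node path (S m)))); auto.
  unfold Rdiv at 2; rewrite Rmult_assoc, Rinv_l; lra.
Qed.

Theorem mainTheorem1 :
  exists (mu : list bool -> R) (X : nat -> bool),
    prob_measure mu /\ computable_measure mu /\
    ~ computably_random mu X /\
    (forall M, martingale mu M -> computable_martingale M -> total M ->
               ~ succeeds M X).
Proof.
  exists mu, path; split; [apply prob_measure_mu|split; [apply computable_measure_mu|split]].
  - intros H; apply (H ratio martingale_ratio computable_martingale_ratio ratio_succeeds).
  - apply total_martingale_fails.
Qed.
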